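(* Suppose that $\varphi_z\in L^2(\mathbb R_+)$ and $\theta_z\in L^2(\mathbb R_+)$ for all $z\in\mathbb C$. For $z\in\mathbb C$ let $\mathcal R(z)$ be the bounded operator in $L^2(\mathbb R_+)$ defined by $$(\mathcal R(z)h)(x)=\theta_z(x)\int_0^x\varphi_z(y)h(y)\,dy+\varphi_z(x)\int_x^\infty\theta_z(y)h(y)\,dy .$$ Then, for all $z\in\mathbb C$, we have $$\mathcal R(z)\colon L^2(\mathbb R_+)\to\mathcal D(A_{\max})$$ and $$(A_{\max}-zI)\,\mathcal R(z)=I .$$
   Context: $\mathbb R_+=(0,\infty)$; $L^2(\mathbb R_+)$ is the complex space and $I$ is the identity operator. Let $p\in C^1(\mathbb R_+)$, $q\in C(\mathbb R_+)$ be real functions having finite limits as $x\to0$, with $p(x)>0$ for all $x\ge0$ (including the limit $p(0)>0$). Put $(\mathcal A u)(x)=-(p(x)u'(x))'+q(x)u(x)$. Fix $\alpha\in\mathbb R\cup\{\infty\}$ and consider the boundary condition (BC): $u'(0)=\alpha u(0)$ (for $\alpha=\infty$ this means $u(0)=0$), where $u(0)=u(+0)$, $u'(0)=u'(+0)$. Solutions: for $z\in\mathbb C$, $\varphi_z$ and $\theta_z$ are the solutions of $-(pu')'+qu=zu$ on $\mathbb R_+$ with $\varphi_z(0)=1$, $\varphi_z'(0)=\alpha$, $\theta_z(0)=0$, $\theta_z'(0)=-p(0)^{-1}$ if $\alpha\in\mathbb R$, and $\varphi_z(0)=0$, $\varphi_z'(0)=1$, $\theta_z(0)=p(0)^{-1}$,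 $\theta_z'(0)=0$ if $\alpha=\infty$. Maximal operator: $A_{\max}u=\mathcal Au$ on the set $\mathcal D(A_{\max})$ of $u$ belonging locally (on $(0,\infty)$) to the Sobolev space $\mathsf H^2$, satisfying (BC), and such that $u\in L^2(\mathbb R_+)$, $\mathcal Au\in L^2(\mathbb R_+)$. *)

(* Defs.v *)
From HB Require Import structures.
From mathcomp Require Import all_boot all_order all_algebra.
From mathcomp Require Import complex.
From mathcomp Require Import all_classical all_reals all_analysis.
Set Implicit Arguments.
Unset Strict Implicit.
Unset Printing Implicit Defensive.
Import Order.TTheory GRing.Theory Num.Theory.
Import numFieldNormedType.Exports.
Local Open Scope classical_set_scope.
Local Open Scope ring_scope.
Local Open Scope complex_scope.

(* Functions on (0, +oo) are represented by total functions on R of which only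
   the values on [Rplus] matter.  Elements of the complex space L^2(0, +oo) are
   represented by functions, equality in L^2 being equality almost everywhere.
   As R[i] carries no topology over R in the library, limits, derivatives,
   measurability and integrals are taken componentwise. *)

Section ComplexValued.
Context {R : realType}.
Implicit Types (f u v : R -> R[i]) (D : set R).

Notation mu := (@lebesgue_measure R).

Definition Rplus : set R := [set x | 0 < x].

Definition eq_aeRplus u v : Prop := {ae mu, forall x, Rplus x -> u x = v x}.

Definition ReF f : R -> R := fun x => complex.Re (f x).
Definition ImF f : R -> R := fun x => complex.Im (f x).

Definition Ccvg_right0 f (l : R[i]) : Prop :=
  ReF f x @[x --> 0^'+] --> complex.Re l /\
  ImF f x @[x --> 0^'+] --> complex.Im l.

Definition Cderivable f (x : R) : Prop :=
  derivable (ReF f) x 1 /\ derivable (ImF f) x 1.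

Definition Cderive f : R -> R[i] :=
  fun x => derive1 (ReF f) x +i* derive1 (ImF f) x.

Definition Ccontinuous_at f (x : R) : Prop :=
  {for x, continuous (ReF f)} /\ {for x, continuous (ImF f)}.

Definition Cmeasurable D f : Prop :=
  measurable_fun D (ReF f) /\ measurable_fun D (ImF f).

Definition Cintegral D f : R[i] :=
  (\int[mu]_(x in D) ReF f x) +i* (\int[mu]_(x in D) ImF f x).

Definition L2norm D f : \bar R :=
  Lnorm mu 2%:E ((fun x => (ComplexField.Normc.normc (f x))%:E) \_ D).

Definition L2 D : set (R -> R[i]) :=
  [set f | Cmeasurable D f /\ (L2norm D f < +oo)%E].

Definition L2loc : set (R -> R[i]) :=
  [set f | forall K : set R, compact K -> K `<=` Rplus -> L2 K f].

Definition L1loc : set (R -> R[i]) :=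
  [set f | locally_integrable Rplus (ReF f) /\ locally_integrable Rplus (ImF f)].

Definition test_function : set (R -> R) :=
  [set eta | (forall (n : nat) (x : R), derivable (derive1n n eta) x 1) /\
     exists a b : R, 0 < a /\ forall x, eta x != 0 -> a <= x <= b].

Definition is_weak_derivative u v : Prop :=
  [/\ L1loc u, L1loc v & forall eta, test_function eta ->
    Cintegral Rplus (fun x => u x * (derive1 eta x)%:C)
    = - Cintegral Rplus (fun x => v x * (eta x)%:C)].

(* a representative of the weak derivative, which is unique up to equality
   almost everywhere on (0, +oo); zero if there is none *)
Definition weak_derivative u : R -> R[i] :=
  xget (cst 0) [set v | is_weak_derivative u v].

Definition H2loc : set (R -> R[i]) :=
  [set u | exists u1 u2 : R -> R[i],
    [/\ is_weak_derivative u u1, is_weak_derivative u1 u2,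
        L2loc u, L2loc u1 & L2loc u2]].

Definition bounded_operator_L2 (T : (R -> R[i]) -> R -> R[i]) : Prop :=
  [/\ forall h, L2 Rplus h -> L2 Rplus (T h),
      forall (c : R[i]) h1 h2, L2 Rplus h1 -> L2 Rplus h2 ->
        eq_aeRplus (T (fun x => c * h1 x + h2 x))
                   (fun x => c * T h1 x + T h2 x)
    & exists M : R, forall h, L2 Rplus h ->
        (L2norm Rplus (T h) <= M%:E * L2norm Rplus h)%E].

End ComplexValued.

Section SturmLiouville.
Context {R : realType}.
Implicit Types (p q : R -> R) (alpha : option R) (u v h : R -> R[i]).

Definition C1_Rplus p : Prop :=
  forall x, Rplus x -> derivable p x 1 /\ {for x, continuous (derive1 p)}.

Definition is_solution p q (z : R[i]) u : Prop :=
  forall x, Rplus x ->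
    [/\ Cderivable u x,
        Cderivable (fun y => (p y)%:C * Cderive u y) x
      & - Cderive (fun y => (p y)%:C * Cderive u y) x + (q x)%:C * u x
        = z * u x].

Definition initial_data u (u0 u1 : R[i]) : Prop :=
  Ccvg_right0 u u0 /\ Ccvg_right0 (Cderive u) u1.

(* The parameter alpha ranges over R extended by a point at infinity, [None];
   [p0] stands for p(0). *)
Definition phi_data alpha u : Prop :=
  if alpha is Some a then initial_data u 1 a%:C else initial_data u 0 1.

Definition theta_data (p0 : R) alpha u : Prop :=
  if alpha is Some _ then initial_data u 0 (- p0^-1)%:C
  else initial_data u (p0^-1)%:C 0.

(* (BC), imposed on the continuously differentiable representative of u *)
Definition boundary_condition alpha u : Prop :=
  exists v, [/\ eq_aeRplus u v,
    forall x, Rplus x -> Cderivable v x /\ Ccontinuous_at (Cderive v) x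
    & if alpha is Some a then
        exists v0 : R[i], initial_data v v0 (a%:C * v0)
      else Ccvg_right0 v 0].

Definition calA p q u : R -> R[i] :=
  fun x => - weak_derivative (fun y => (p y)%:C * weak_derivative u y) x
           + (q x)%:C * u x.

Definition dom_Amax p q alpha : set (R -> R[i]) :=
  [set u | [/\ H2loc u, boundary_condition alpha u,
               L2 Rplus u & L2 Rplus (calA p q u)]].

Definition Rop (phi theta : R[i] -> R -> R[i]) (z : R[i]) h : R -> R[i] :=
  fun x =>
    theta z x * Cintegral [set` `]0, x]] (fun y => phi z y * h y)
  + phi z x * Cintegral [set` `[x, +oo[] (fun y => theta z y * h y).

End SturmLiouville.

(* Main.v *)
Require Import Defs.
From mathcomp Require Import all_boot all_order all_algebra.
From mathcomp Require Import complex.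
From mathcomp Require Import ring lra.
From mathcomp Require Import all_classical all_reals all_analysis.
From mathcomp Require Import measurable_realfun.
Import Order.TTheory GRing.Theory Num.Theory.
Import numFieldNormedType.Exports.
Local Open Scope classical_set_scope.
Local Open Scope ring_scope.
Local Open Scope complex_scope.

(* Write u = R(z)h = theta F + phi G with F(x) = int_0^x phi h and
   G(x) = int_x^oo theta h, which are absolutely continuous with F' = phi h and
   G' = - theta h.  The terms containing h cancel in u', so that
   u' = theta' F + phi' G is continuous, while in (p u')' they add up to
   p (theta' phi - phi' theta) h = - h: this Wronskian is constant, and its limit
   at 0 is -1 by the initial data.  Hence - (p u')' + q u = z u + h.  Near 0, F
   vanishes and G has a limit, so u inherits the boundary condition of phi.
   Boundedness is the Cauchy-Schwarz inequality.

   As [calA] picks an arbitrary weak derivative, uniqueness of weak derivatives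
   is needed.  It is tested on
   exp (- 1 / (n (x - a))) exp (- 1 / (n (b - x))), extended by 0, which tends to
   the indicator function of ]a, b[ as n grows. *)

Set Implicit Arguments.
Unset Strict Implicit.
Unset Printing Implicit Defensive.

(** * Smooth bump functions *)

Section SmoothBump.
Context {R : realType}.
Implicit Types (a b c x y : R) (f g : R -> R) (k l m n : nat).

(** As h is merely square-integrable, the densities phi h and - theta h need not be continuous, and
    the classical product rule does not apply to theta F and phi G. Local absolute continuity is
    therefore used in integrated form: f b - f a is the integral of a density over [a, b].
    Integration by parts against a test function then yields weak derivatives directly, and
    classical derivatives are recovered wherever the density is continuous, as it is for u but in
    general not for p u'.

    In every product that occurs, one factor has a continuous density: a solution, its
    quasi-derivative p phi' or p theta', 1 / p, or a test function. A Leibniz formula with one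
    continuous density is thus enough, and it is proved by bisection rather than by differentiation
    almost everywhere. Lebesgue differentiation enters only in the uniqueness of weak derivatives,
    to pass from vanishing integrals over intervals to a function vanishing almost everywhere. *)

Definition flat k x : R := if 0 < x then x^-1 ^+ k * expR (- x^-1) else 0.

Lemma flat_le0 k x : x <= 0 -> flat k x = 0.
Proof. by rewrite /flat; case: ltP. Qed.

(** The exponential series gives e^t >= t^(k+2) / (k+2)! for t >= 0; at t = 1 / x this reads x^-k
    e^(-1/x) <= (k+2)! x^2. The factor x^2 is what differentiability at 0 requires. *)
Lemma flat_quadratic k : exists C : R, forall x, `|flat k x| <= C * x ^+ 2.
Proof.
exists (k.+2)`!%:R => x; rewrite /flat; case: ltP => x0; last first.
  by rewrite normr0 mulr_ge0// sqr_ge0.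
rewrite ger0_norm; last by rewrite mulr_ge0 ?expR_ge0// exprn_ge0// invr_ge0 ltW.
have xV0 : 0 <= x^-1 by rewrite invr_ge0 ltW.
have xn0 : x != 0 by rewrite gt_eqF.
have f0 : 0 < (k.+2)`!%:R :> R by rewrite ltr0n fact_gt0.
have := expR_ge1Dxn k.+1 xV0.
move=> /(le_trans _) => /(_ (x^-1 ^+ k.+2 / (k.+2)`!%:R)).
rewrite lerDr ler01 => /(_ isT); rewrite ler_pdivrMr// => H.
rewrite expRN ler_pdivrMr ?expR_gt0//.
have -> : x^-1 ^+ k = x ^+ 2 * x^-1 ^+ k.+2.
  by rewrite -(addn2 k) exprD mulrCA -exprMn mulfV// expr1n mulr1.
apply: le_trans (ler_wpM2l (sqr_ge0 x) H) _; rewrite le_eqVlt.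
by apply/orP; left; apply/eqP; ring.
Qed.

Lemma is_derive0_quadratic (f : R -> R) (C : R) :
  (forall x, `|f x| <= C * x ^+ 2) -> is_derive (0 : R) (1 : R) f (0 : R).
Proof.
move=> fC; have f0 : f 0 = 0.
  by apply/eqP; rewrite -normr_le0 (le_trans (fC 0))// expr0n mulr0.
have C0 : 0 <= C by have := fC 1; rewrite expr1n mulr1; exact: le_trans.
have H : h^-1 *: ((f \o shift 0) (h *: (1:R)) - f 0) @[h --> (0:R)^'] --> (0:R).
  apply/cvgr0Pnorm_le => e e0.
  near=> h.
  rewrite /= f0 subr0 addr0 /GRing.scale/= mulr1 normrM normfV.
  have h0 : 0 < `|h| by rewrite normr_gt0; near: h; exact: nbhs_dnbhs_neq.
  rewrite mulrC ler_pdivrMr// (le_trans (fC h))//.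
  rewrite -(real_normK (num_real h)) expr2 mulrA ler_pM2r//.
  (* C may be 0, whereas the division below needs a positive constant. *)
  apply: (@le_trans _ _ ((C + 1) * `|h|)).
    by rewrite ler_wpM2r// lerDl.
  rewrite mulrC -ler_pdivlMr ?ltr_wpDl//.
  near: h; apply: dnbhs0_le; by rewrite divr_gt0// ltr_wpDl.
apply: DeriveDef; first by apply/cvg_ex; exists 0.
exact: cvg_lim.
Unshelve. all: by end_near. Qed.

(** The derivative stays in the family, so smoothness reduces to the stability of a span. On either
    side of 0 this is ordinary calculus; at the gluing point the quadratic bound gives the
    derivative 0. *)
Lemma is_derive_flat k x :
  is_derive x (1 : R) (flat k) (flat k.+2 x - k%:R * flat k.+1 x).
Proof.
have [x0|x0|->] := ltgtP x 0.
- rewrite !flat_le0 ?ltW// mulr0 subr0.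
  apply: (@near_eq_is_derive _ _ _ (cst 0)).
  near=> y; rewrite flat_le0// ltW//.
  by near: y; exact: lt_nbhsl.
- rewrite /flat x0.
  apply: (@near_eq_is_derive _ _ _ (fun y => y^-1 ^+ k * expR (- y^-1))).
    by near=> y; rewrite ifT//; near: y; exact: lt_nbhsr.
  have xn0 : x != 0 by rewrite gt_eqF.
  have dV : is_derive x (1 : R) (fun y : R => y^-1) (- x ^- 2).
    have := @is_deriveV R id x 1 1 xn0 (is_derive_id _ _).
    by rewrite /GRing.scale/= mulr1.
  have dE : is_derive x (1:R) (fun y : R => expR (- y^-1))
    (expR (- x^-1) * (x ^- 2)).
    apply: (@is_derive1_comp _ expR (fun y => - y^-1)).
    by have := is_deriveN dV; rewrite opprK.
  have := is_deriveX k dV; rewrite exprfctE => dX.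
  have := is_deriveM dX dE.
  rewrite /GRing.scale/= => D; refine (is_derive_eq D _).
  rewrite -exprVn.
  case: k {dX D} => [|k]/=; first by rewrite expr0 !mul0r mulr0 addr0 mul1r subr0 mulrC.
  rewrite !exprS; ring.
- rewrite !flat_le0// mulr0 subr0.
  have [C] := flat_quadratic k; exact: is_derive0_quadratic.
Unshelve. all: by end_near. Qed.

Variables a b c : R.

(* The span of the functions flat k (c (x - a)) flat l (c (b - x)), which is
   stable under differentiation. *)
Inductive bump_span : (R -> R) -> Prop :=
| BumpBase k l : bump_span (fun x => flat k (c * (x - a)) * flat l (c * (b - x)))
| BumpLin r f g : bump_span f -> bump_span g -> bump_span (fun x => r * f x + g x).

Lemma bump_span_derive f : bump_span f ->
  exists2 g, bump_span g & forall x, is_derive x (1 : R) f (g x).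
Proof.
elim=> [k l|r f1 f2 _ [g1 s1 d1] _ [g2 s2 d2]].
- pose B i j x := flat i (c * (x - a)) * flat j (c * (b - x)).
  (* The coefficients c and - c are the inner derivatives of c (x - a) and c (b - x). The summand
     with coefficient 0 ends the chain of [BumpLin]; the zero function belongs to the span as - B +
     B. *)
  exists (fun x => c * B k.+2 l x + (- c * k%:R * B k.+1 l x +
           (- c * B k l.+2 x + (c * l%:R * B k l.+1 x + 0 * B k l x)))).
    have H s r i j : bump_span s -> bump_span (fun x => r * B i j x + s x).
      by move=> ?; apply: BumpLin => //; exact: BumpBase.
    do 4 apply: (H).
    have -> : (fun x => 0 * B k l x) = (fun x => (-1) * B k l x + B k l x).
      by apply/funext => x; ring.
    by apply: BumpLin; exact: BumpBase.
  move=> x.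
  have dl : is_derive x (1 : R) (fun y => c * (y - a)) c.
    have := is_deriveZ c (is_deriveB (is_derive_id x (1 : R)) (is_derive_cst a x 1)).
    by rewrite /GRing.scale/= subr0 mulr1.
  have dr : is_derive x (1 : R) (fun y => c * (b - y)) (- c).
    have := is_deriveZ c (is_deriveB (is_derive_cst b x (1 : R)) (is_derive_id x 1)).
    by rewrite /GRing.scale/= sub0r mulrN1.
  have Dl := @is_derive1_comp _ _ (fun y => c * (y - a)) _ _ _
    (is_derive_flat k (c * (x - a))) dl.
  have Dr := @is_derive1_comp _ _ (fun y => c * (b - y)) _ _ _
    (is_derive_flat l (c * (b - x))) dr.
  refine (is_derive_eq (is_deriveM Dl Dr) _).
  rewrite /GRing.scale/= /B; ring.
- exists (fun x => r * g1 x + g2 x); first exact: BumpLin.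
  move=> x; exact: (is_deriveD (is_deriveZ r (d1 x)) (d2 x)).
Qed.

Lemma bump_span_derive1n n f : bump_span f -> bump_span (derive1n n f).
Proof.
move=> sf; elim: n => [//|n IH]; rewrite derive1nS.
have [g sg dg] := bump_span_derive IH.
rewrite (_ : derive1 _ = g)//.
by apply/funext => x; rewrite derive1E; have := dg x => ?; rewrite derive_val.
Qed.

Definition bump x : R := flat 0 (c * (x - a)) * flat 0 (c * (b - x)).

Lemma bump_derivable n x : derivable (derive1n n bump) x 1.
Proof.
have sb : bump_span bump by exact: BumpBase.
have [g _ dg] := bump_span_derive (bump_span_derive1n n sb).
exact: (@ex_derive _ _ _ _ _ _ _ (dg x)).
Qed.

Lemma bump_itv x : 0 < c -> bump x != 0 -> a <= x <= b.
Proof.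
move=> c0; rewrite /bump mulf_eq0 negb_or => /andP[].
have [ax _|ax] := leP a x; last first.
  by rewrite flat_le0 ?eqxx// pmulr_rle0// subr_le0 ltW.
have [//|xb] := leP x b.
by rewrite flat_le0 ?eqxx// pmulr_rle0// subr_le0 ltW.
Qed.

End SmoothBump.

(** * Pointwise limit of the bumps *)

Section BumpLimit.
Context {R : realType}.
Implicit Types (a b x : R) (n : nat).

Lemma flat0_ge0_le1 x : 0 <= flat 0 x <= 1.
Proof.
rewrite /flat; case: ltP => x0; last by rewrite lexx ler01.
rewrite expr0 mul1r expR_ge0/= -expR0 ler_expR oppr_le0 invr_ge0 ltW//.
Qed.

Lemma bump_ge0_le1 a b c x : 0 <= bump a b c x <= 1.
Proof.
have /andP[? ?] := flat0_ge0_le1 (c * (x - a)).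
have /andP[? ?] := flat0_ge0_le1 (c * (b - x)).
by rewrite /bump mulr_ge0// mulr_ile1.
Qed.

Lemma flat0_cvg1 x : 0 < x -> flat 0 (n.+1%:R * x) @[n --> \oo] --> (1 : R).
Proof.
move=> x0.
have -> : (fun n => flat 0 (n.+1%:R * x)) = (fun n => expR (- (n.+1%:R^-1 * x^-1))).
  apply/funext => n; rewrite /flat expr0 mul1r pmulr_rgt0 ?ltr0n// x0.
  by rewrite invfM.
rewrite -[X in _ --> X](@expR0 R); apply: (@cvg_comp _ _ _ _ _ _ (nbhs (0:R))).
  have := cvgN (@cvgM _ _ _ _ harmonic (cst x^-1) _ _ (@cvg_harmonic R) (cvg_cst _)).
  by rewrite mul0r oppr0; exact.
exact: continuous_expR.
Qed.

(** Inside the interval both arguments of [flat] tend to infinity; elsewhere, endpoints included,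
    every bump is already 0. Hence the limit is the indicator of the open interval. *)
Lemma bump_cvg a b x :
  bump a b n.+1%:R x @[n --> \oo] --> (\1_`]a, b[%classic x : R).
Proof.
rewrite indicE; have [|] := boolP (x \in `]a, b[%classic).
  rewrite inE/= in_itv/= => /andP[ax xb].
  rewrite /bump -[1%:R](mulr1 1); apply: cvgM; apply: flat0_cvg1; rewrite subr_gt0//.
rewrite notin_setE/= in_itv/= => /negP; rewrite negb_and -!leNgt => axb.
rewrite (_ : (fun n => bump a b n.+1%:R x) = fun=> 0); first exact: cvg_cst.
apply/funext => n; rewrite /bump.
case/orP: axb => H.
  by rewrite flat_le0 ?mul0r// pmulr_rle0 ?ltr0n// subr_le0.
by rewrite [X in _ * X]flat_le0 ?mulr0// pmulr_rle0 ?ltr0n// subr_le0.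
Qed.

Lemma bump_test_function a b c : 0 < a -> 0 < c ->
  test_function (bump a b c).
Proof.
move=> a0 c0; split; first exact: bump_derivable.
exists a, b; split => // x; exact: bump_itv.
Qed.

End BumpLimit.

(** * Absolutely continuous functions on the positive half-line *)

Section Integrable.
Context {R : realType}.
Notation mu := (@lebesgue_measure R).
Implicit Types (f g : R -> R) (D E : set (measurableTypeR R)).

(* R carries two measurable structures with distinct displays; the Lebesgue
   measure lives on [measurableTypeR R]. *)
Definition intg D f := mu.-integrable D (EFin \o f).

Lemma intgD D f g : measurable D -> intg D f -> intg D g ->
  intg D (fun x => f x + g x).
Proof. by move=> mD fi gi; exact: (integrableD mD fi gi). Qed.

Lemma intgZ D (k : R) f : measurable D -> intg D f -> intg D (fun x => k * f x).
Proof. by move=> mD fi; exact: (integrableZl mD k fi). Qed.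

Lemma intgN D f : measurable D -> intg D f -> intg D (fun x => - f x).
Proof.
move=> mD fi; rewrite (_ : (fun _ => _) = fun x => (-1) * f x); first exact: intgZ.
by apply/funext => x; rewrite mulN1r.
Qed.

Lemma intgB D f g : measurable D -> intg D f -> intg D g ->
  intg D (fun x => f x - g x).
Proof. by move=> mD fi gi; apply: intgD => //; exact: intgN. Qed.

Lemma intgS D E f :
  measurable D -> measurable E -> E `<=` D ->
  intg D f -> intg E f.
Proof. by move=> mD mE ED; exact: integrableS. Qed.

Lemma intg_eq D f g : measurable D -> (forall x, D x -> f x = g x) ->
  intg D f -> intg D g.
Proof.
move=> mD fg; apply: eq_integrable => // x; rewrite inE => Dx /=.
by rewrite fg.
Qed.

Lemma intg_measurable D f : intg D f -> measurable_fun D f.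
Proof. by move/(measurable_int mu)/measurable_EFinP. Qed.

Lemma intg_le D f g : measurable D -> measurable_fun D f ->
  (forall x, D x -> `|f x| <= g x) -> intg D g -> intg D f.
Proof.
move=> mD mf fg; apply: le_integrable => //; first exact/measurable_EFinP.
by move=> x Dx; rewrite /= lee_fin (le_trans (fg _ Dx))// ler_norm.
Qed.

Lemma intg_bounded D f g (M : R) : measurable D -> intg D f ->
  measurable_fun D g -> (forall x, D x -> `|g x| <= M) ->
  intg D (fun x => f x * g x).
Proof.
move=> mD fi mg gM; apply: (@intg_le _ _ (fun x => M * `|f x|)) => //.
- by apply: measurable_funM => //; exact: intg_measurable.
- by move=> x Dx; rewrite normrM mulrC ler_wpM2r// gM.
- by apply: intgZ => //; exact: integrable_norm.
Qed.

Lemma Rintegral_eq D f g : (forall x, D x -> f x = g x) ->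
  \int[mu]_(x in D) f x = \int[mu]_(x in D) g x.
Proof. by move=> fg; apply: eq_Rintegral => x; rewrite inE => /fg. Qed.

Lemma Rintegral_supp D E f : E `<=` D ->
  (forall x, D x -> ~ E x -> f x = 0) ->
  \int[mu]_(x in D) f x = \int[mu]_(x in E) f x.
Proof.
move=> ED f0; rewrite Rintegral_mkcond [RHS]Rintegral_mkcond.
congr Rintegral; apply/funext => x; rewrite !patchE.
case: ifPn => [|] xD; case: ifPn => [|] xE //.
- by apply: f0; [exact: set_mem|move/mem_set; apply/negP].
- by move: xE xD => /set_mem/ED/mem_set ->.
Qed.

Lemma Rintegral_cat (a c b : R) f : a <= c -> c <= b -> intg `[a, b] f ->
  \int[mu]_(x in `[a, b]) f x =
  \int[mu]_(x in `[a, c]) f x + \int[mu]_(x in `[c, b]) f x.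
Proof.
move=> ac cb fi; apply/eqP; rewrite addrC -subr_eq; apply/eqP.
rewrite Rintegral_itvB ?bnd_simp//.
apply: Rintegral_itv_obnd_cbnd; apply: intgS fi => //.
by apply: subset_itv; rewrite bnd_simp.
Qed.

Lemma intg_cst (a b c : R) : intg `[a, b] (fun=> c).
Proof.
apply: measurable_bounded_integrable => //.
  by apply: compact_finite_measure; exact: segment_compact.
by exists `|c|; split; [rewrite num_real|move=> x cx y _ /=; exact: ltW].
Qed.

Lemma Rintegral_itv_cst (a b c : R) : a <= b ->
  \int[mu]_(x in `[a, b]) c = c * (b - a).
Proof.
move=> ab; rewrite Rintegral_cst//; congr (_ * _).
transitivity (fine (lebesgue_measure (`[a, b]%classic : set R))); first by [].
rewrite lebesgue_measure_itv/= lte_fin.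
case: ifPn => [//|]; rewrite -leNgt => ba.
by rewrite (@le_anti _ _ a b) ?ab// subrr.
Qed.

End Integrable.

(** * Continuous functions on the open half-line *)

Section PositiveHalfLine.
Context {R : realType}.
Notation mu := (@lebesgue_measure R).
Implicit Types (f g : R -> R) (a b : R).

Lemma Rplus_itv : @Rplus R = `]0, +oo[%classic.
Proof. by rewrite /Rplus set_itvoy. Qed.

Lemma open_Rplus : open (@Rplus R).
Proof. exact: open_gt. Qed.

Lemma measurable_Rplus : measurable (@Rplus R : set (measurableTypeR R)).
Proof. by rewrite Rplus_itv. Qed.

Lemma segment_Rplus a b : 0 < a -> `[a, b] `<=` @Rplus R.
Proof. by move=> a0 x /=; rewrite in_itv/= => /andP[/(lt_le_trans a0)]. Qed.

Lemma segment_sub a b c d : c <= a -> b <= d -> `[a, b] `<=` (`[c, d] : set R).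
Proof. by move=> ca bd; apply: subset_itv; rewrite bnd_simp. Qed.

Definition cont_pos f := forall x, 0 < x -> {for x, continuous f}.

Lemma cont_pos_within f a b : 0 < a -> cont_pos f -> {within `[a, b], continuous f}.
Proof.
move=> a0 cf; apply: continuous_in_subspaceT => x; rewrite inE => xab.
by apply: cf; exact: segment_Rplus xab.
Qed.

Lemma cont_pos_measurable f : cont_pos f -> measurable_fun Rplus f.
Proof.
move=> cf; apply: open_continuous_measurable_fun; first exact: open_Rplus.
by move=> x; rewrite inE; exact: cf.
Qed.

Lemma cont_pos_measurable_seg f a b : 0 < a -> cont_pos f ->
  measurable_fun `[a, b] f.
Proof.
move=> a0 /cont_pos_measurable; apply: measurable_funS.
  exact: measurable_Rplus.
exact: segment_Rplus.
Qed.

Lemma cont_pos_intg f a b : 0 < a -> cont_pos f -> intg `[a, b] f.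
Proof.
move=> a0 cf; apply: continuous_compact_integrable; first exact: segment_compact.
exact: cont_pos_within.
Qed.

Lemma cont_pos_norm f : cont_pos f -> cont_pos (fun x => `|f x|).
Proof.
by move=> cf x x0; apply: continuous_comp; [exact: cf|exact: norm_continuous].
Qed.

Lemma cont_posD f g : cont_pos f -> cont_pos g -> cont_pos (fun x => f x + g x).
Proof. by move=> cf cg x x0; apply: cvgD; [exact: cf|exact: cg]. Qed.

Lemma cont_posN f : cont_pos f -> cont_pos (fun x => - f x).
Proof. by move=> cf x x0; apply: cvgN; exact: cf. Qed.

Lemma cont_posB f g : cont_pos f -> cont_pos g -> cont_pos (fun x => f x - g x).
Proof. by move=> cf cg; apply: cont_posD => //; exact: cont_posN. Qed.

Lemma cont_posM f g : cont_pos f -> cont_pos g -> cont_pos (fun x => f x * g x).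
Proof. by move=> cf cg x x0; apply: cvgM; [exact: cf|exact: cg]. Qed.

Lemma cont_pos_cst (c : R) : cont_pos (fun=> c).
Proof. by move=> x x0; exact: cvg_cst. Qed.

Lemma cont_pos_bounded f a b : 0 < a -> a <= b -> cont_pos f ->
  exists2 M, 0 <= M & forall x, `[a, b]%classic x -> `|f x| <= M.
Proof.
move=> a0 ab /cont_pos_norm cf.
have [c _ fc] := EVT_max ab (cont_pos_within a0 cf).
by exists `|f c| => // x xab; exact: fc.
Qed.

Lemma is_derive_cont f (df : R) (x : R) : is_derive x (1 : R) f df -> {for x, continuous f}.
Proof.
move=> H; apply/differentiable_continuous/derivable1_diffP.
exact: (@ex_derive _ _ _ _ _ _ _ H).
Qed.

Lemma near_pos (P : R -> Prop) (x : R) : 0 < x -> (forall y, 0 < y -> P y) ->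
  \forall y \near nbhs x, P y.
Proof. by move=> x0 HP; near=> y; apply: HP; near: y; exact: lt_nbhsr.
Unshelve. all: by end_near. Qed.

Lemma cont_pos_eq f g : (forall x, 0 < x -> f x = g x) -> cont_pos f -> cont_pos g.
Proof.
move=> fg cf x x0; rewrite /prop_for /continuous_at -(fg x x0).
apply: cvg_trans (cf x x0); apply: near_eq_cvg.
exact: near_pos.
Qed.

End PositiveHalfLine.

(** * Local absolute continuity and integration by parts *)

Section AbsolutelyContinuous.
Context {R : realType}.
Notation mu := (@lebesgue_measure R).
Implicit Types (f g v w : R -> R) (a b x y : R).

(* f is locally absolutely continuous on (0, +oo) with density w. *)
Definition ac f w := forall a b, 0 < a -> a <= b ->
  intg `[a, b] w /\ f b - f a = \int[mu]_(x in `[a, b]) w x.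

Lemma ac_eq f w g v : (forall x, 0 < x -> f x = g x) ->
  (forall x, 0 < x -> w x = v x) -> ac f w -> ac g v.
Proof.
move=> fg wv H a b a0 ab; have [wi fE] := H a b a0 ab; split.
  by apply: intg_eq wi => // x /(segment_Rplus a0) /wv.
rewrite -!fg//; last exact: lt_le_trans ab.
by rewrite fE; apply: Rintegral_eq => x /(segment_Rplus a0) /wv.
Qed.

Lemma acD f w g v : ac f w -> ac g v ->
  ac (fun x => f x + g x) (fun x => w x + v x).
Proof.
move=> H K a b a0 ab; have [wi fE] := H a b a0 ab; have [vi gE] := K a b a0 ab.
split; first exact: intgD.
by rewrite RintegralD// -fE -gE; ring.
Qed.

Lemma acZ (k : R) f w : ac f w -> ac (fun x => k * f x) (fun x => k * w x).
Proof.
move=> H a b a0 ab; have [wi fE] := H a b a0 ab.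
split; first exact: intgZ.
by rewrite RintegralZl// -fE mulrBr.
Qed.

Lemma acN f w : ac f w -> ac (fun x => - f x) (fun x => - w x).
Proof. by move/(acZ (-1)); apply: ac_eq => x _; rewrite mulN1r. Qed.

Lemma acB f w g v : ac f w -> ac g v ->
  ac (fun x => f x - g x) (fun x => w x - v x).
Proof. by move=> H /acN; exact: acD. Qed.

(** The primitive is anchored at x / 2, a base point that is positive and strictly below x, so that
    x is interior to the interval of integration and the fundamental theorem of calculus applies
    there. *)
Lemma ac_nearE f w x : 0 < x -> ac f w ->
  \forall y \near nbhs x, f y = f (x / 2) + \int[mu]_(t in `[x / 2, y]) w t.
Proof.
move=> x0 H; near=> y.
have xy : x / 2 <= y.
  by apply: ltW; near: y; apply: lt_nbhsr; rewrite ltr_pdivrMr// ltr_pMr// ltr1n.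
have [_ <-] := H (x / 2) y (divr_gt0 x0 (ltr0Sn _ 1)) xy.
by rewrite subrKC.
Unshelve. all: by end_near. Qed.

Lemma ac_cont f w : ac f w -> cont_pos f.
Proof.
move=> H x x0.
have h0 : 0 < x / 2 by rewrite divr_gt0.
have hx : x / 2 < x by rewrite ltr_pdivrMr// ltr_pMr// ltr1n.
have hb : x / 2 <= x + 1 by rewrite (le_trans (ltW hx))// lerDl.
have [wi _] := H (x / 2) (x + 1) h0 hb.
have := parameterized_integral_continuous hb wi.
rewrite continuous_within_itvP; last by rewrite (lt_trans hx)// ltrDl.
case=> /(_ x) + _ _; rewrite in_itv/= hx ltrDl ltr01 => /(_ isT) cF.
have cG : {for x, continuous (fun y => f (x / 2) + parameterized_integral mu (x / 2) y w)}.
  by apply: cvgD => //; exact: cvg_cst.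
have E := ac_nearE x0 H.
rewrite /prop_for /continuous_at (nbhs_singleton E).
by apply: cvg_trans cG; apply: near_eq_cvg; near do apply/esym.
Unshelve. all: by end_near. Qed.

Lemma ac_is_derive f w x : ac f w -> 0 < x -> {for x, continuous w} ->
  is_derive x (1 : R) f (w x).
Proof.
move=> H x0 cw.
have h0 : 0 < x / 2 by rewrite divr_gt0.
have hx : x / 2 < x by rewrite ltr_pdivrMr// ltr_pMr// ltr1n.
have hb : x / 2 <= x + 1 by rewrite (le_trans (ltW hx))// lerDl.
have [wi _] := H (x / 2) (x + 1) h0 hb.
have x1 : x < x + 1 by rewrite ltrDl.
have [dF FE] := continuous_FTC1_closed x1 wi hx cw.
have E := ac_nearE x0 H.
apply: (@near_eq_is_derive _ _ _ (fun y => f (x / 2) + \int[mu]_(t in `[x / 2, y]) w t)).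
  by near do apply/esym.
have dF' := DeriveDef dF (erefl _).
rewrite -derive1E FE in dF'.
by have := is_deriveD (is_derive_cst (f (x / 2)) x (1 : R)) dF'; rewrite add0r.
Unshelve. all: by end_near. Qed.

Lemma C1_ac f w : (forall x, 0 < x -> is_derive x (1 : R) f (w x)) -> cont_pos w ->
  ac f w.
Proof.
move=> df cw a b a0; rewrite le_eqVlt => /predU1P[<-|ab].
  by rewrite subrr set_itv1 Rintegral_set1; split=> //; rewrite -set_itv1; exact: cont_pos_intg.
split; first exact: cont_pos_intg.
rewrite /Rintegral (@continuous_FTC2 _ w f)//.
- exact: cont_pos_within.
- split.
  + move=> x; rewrite in_itv/= => /andP[/(lt_trans a0) x0 _].
    by have := df x x0 => ?; exact: ex_derive.
  + by apply: cvg_at_right_filter; exact: (is_derive_cont (df a a0)).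
  + by apply: cvg_at_left_filter; exact: (is_derive_cont (df b (lt_trans a0 ab))).
- move=> x; rewrite in_itv/= => /andP[/(lt_trans a0) x0 _].
  by rewrite derive1E; have := df x x0 => ?; rewrite derive_val.
Qed.

(* Bisecting [a, b] n times divides the bound by 2 ^ n. *)
Lemma additive_superlinear_eq0 (D W : R -> R -> R) (C a b : R) :
  (forall x y z, a <= x -> x <= y -> y <= z -> z <= b -> D x z = D x y + D y z) ->
  (forall x y z, a <= x -> x <= y -> y <= z -> z <= b -> W x z = W x y + W y z) ->
  (forall x y, a <= x -> x <= y -> y <= b -> `|D x y| <= C * (y - x) * W x y) ->
  a <= b -> D a b = 0.
Proof.
move=> Dadd Wadd DW ab.
have H n x y : a <= x -> x <= y -> y <= b ->
    `|D x y| <= (1 / 2) ^+ n * (C * (y - x) * W x y).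
  elim: n x y => [|n IH] x y ax xy yb; first by rewrite expr0 mul1r DW.
  pose m := (x + y) / 2.
  have xm : x <= m by rewrite /m; lra.
  have my : m <= y by rewrite /m; lra.
  rewrite (Dadd x m y)// (le_trans (ler_normD _ _))//.
  have I1 := IH x m ax xm (le_trans my yb).
  have I2 := IH m y (le_trans ax xm) my yb.
  rewrite (le_trans (lerD I1 I2))// (Wadd x m y)// exprS.
  by rewrite le_eqVlt; apply/orP; left; apply/eqP; rewrite /m; field.
apply/eqP; rewrite -normr_le0.
have : (fun n => (1 / 2) ^+ n * (C * (b - a) * W a b)) @ \oo --> 0.
  rewrite -[X in _ --> X](mul0r (C * (b - a) * W a b)); apply: cvgM; last exact: cvg_cst.
  by apply: cvg_expr; rewrite ger0_norm; lra.
move=> L; rewrite -(cvg_lim _ L)//; apply: limr_ge; first by apply/cvg_ex; exists 0.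
by near=> n; exact: H.
Unshelve. all: by end_near. Qed.

(* The defect of the Leibniz formula is additive over intervals, and on [x, y]
   it is at most 2 M (y - x) times the integral of |w|, where |v| <= M. *)
Lemma acM f w g v : ac f w -> ac g v -> cont_pos v ->
  ac (fun x => f x * g x) (fun x => w x * g x + f x * v x).
Proof.
move=> H K cv.
have cf := ac_cont H; have cg := ac_cont K.
have wg a b : 0 < a -> a <= b -> intg `[a, b] (fun x => w x * g x).
  move=> a0 ab; have [wi _] := H a b a0 ab.
  have [M _ gM] := cont_pos_bounded a0 ab cg.
  by apply: (intg_bounded _ wi _ gM) => //; exact: cont_pos_measurable_seg.
have fv a b : 0 < a -> intg `[a, b] (fun x => f x * v x).
  by move=> a0; apply: cont_pos_intg => //; exact: cont_posM.
have wgfv a b : 0 < a -> a <= b -> intg `[a, b] (fun x => w x * g x + f x * v x).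
  by move=> a0 ab; apply: intgD => //; [exact: wg|exact: fv].
move=> a b a0 ab; split; first exact: wgfv.
pose D x y := f y * g y - f x * g x - \int[mu]_(t in `[x, y]) (w t * g t + f t * v t).
pose W x y := \int[mu]_(t in `[x, y]) `|w t|.
have [M M0 vM] := cont_pos_bounded a0 ab cv.
have wn x y : 0 < x -> x <= y -> intg `[x, y] (fun t => `|w t|).
  by move=> x0 xy; have [wi _] := H x y x0 xy; exact: integrable_norm.
have Df x s t y : 0 < x -> x <= s -> s <= t -> t <= y -> `|f t - f s| <= W x y.
  move=> x0 xs st ty; have s0 := lt_le_trans x0 xs.
  have [wi ->] := H s t s0 st.
  apply: le_trans (le_normr_Rintegral _ wi) _ => //.
  rewrite /W (@Rintegral_cat _ x s y)//; last 2 first.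
    exact: le_trans ty.
    by apply: wn => //; exact: le_trans (le_trans st ty).
  rewrite (@Rintegral_cat _ s t y)//; last by apply: wn => //; exact: le_trans ty.
  rewrite addrCA lerDl addr_ge0//; exact: Rintegral_ge0.
have Dg x s t y : a <= x -> x <= s -> s <= t -> t <= y -> y <= b ->
    `|g t - g s| <= M * (y - x).
  move=> ax xs st ty yb; have s0 := lt_le_trans a0 (le_trans ax xs).
  have [vi ->] := K s t s0 st.
  apply: le_trans (le_normr_Rintegral _ vi) _ => //.
  apply: (@le_trans _ _ (\int[mu]_(u in `[s, t]) M)).
    apply: le_Rintegral => //; [exact: integrable_norm|exact: intg_cst|].
    move=> u ust; apply: vM; apply: segment_sub ust; first exact: le_trans xs.
    exact: le_trans yb.
  by rewrite Rintegral_itv_cst// ler_wpM2l// lerB.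
suff : D a b = 0 by move/eqP; rewrite subr_eq0 => /eqP.
apply: (@additive_superlinear_eq0 D W (2 * M)) => //.
- move=> x y z ax xy yz zb; have x0 := lt_le_trans a0 ax.
  rewrite /D (@Rintegral_cat _ x y z)//; first by ring.
  by apply: wgfv => //; exact: le_trans yz.
- move=> x y z ax xy yz zb; have x0 := lt_le_trans a0 ax.
  by rewrite /W (@Rintegral_cat _ x y z)//; apply: wn => //; exact: le_trans yz.
move=> x y ax xy yb; have x0 := lt_le_trans a0 ax.
have [wi fE] := H x y x0 xy; have [vi gE] := K x y x0 xy.
have i1 : intg `[x, y] (fun t => w t * g y).
  by apply: (intg_eq _ _ (intgZ (g y) _ wi)) => // t _; rewrite mulrC.
have i2 : intg `[x, y] (fun t => f x * v t) by exact: intgZ.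
(* Since f y g y - f x g x = (f y - f x) g y + f x (g y - g x), the defect is an integral in which
   every term carries an increment of f or of g. *)
have DE : D x y = \int[mu]_(t in `[x, y])
    (w t * (g y - g t) + (f x - f t) * v t).
  have -> : \int[mu]_(t in `[x, y]) (w t * (g y - g t) + (f x - f t) * v t) =
      \int[mu]_(t in `[x, y]) ((w t * g y + f x * v t) - (w t * g t + f t * v t)).
    by apply: Rintegral_eq => t _; ring.
  rewrite RintegralB//; last 2 first.
    exact: intgD.
    exact: wgfv.
  rewrite RintegralD// RintegralZr// RintegralZl// -fE -gE /D; ring.
have WM0 : 0 <= M * (y - x) by rewrite mulr_ge0// subr_ge0.
have iD : intg `[x, y] (fun t => w t * (g y - g t) + (f x - f t) * v t).
  have i3 : intg `[x, y] (fun t => (w t * g y + f x * v t) - (w t * g t + f t * v t)).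
    by apply: intgB => //; [exact: intgD|exact: wgfv].
  by apply: intg_eq i3 => // t _; ring.
have iB1 : intg `[x, y] (fun t => (M * (y - x)) * `|w t|).
  by apply: intgZ => //; exact: wn.
rewrite DE; apply: le_trans (le_normr_Rintegral _ iD) _ => //.
(* The increment of g is at most M (y - x) and that of f at most W x y. After integration each of
   the two summands contributes M (y - x) W x y, whence the constant 2 M. *)
apply: (@le_trans _ _ (\int[mu]_(t in `[x, y]) ((M * (y - x)) * `|w t| + W x y * M))).
  apply: le_Rintegral => //.
  - exact: integrable_norm.
  - by apply: intgD => //; exact: intg_cst.
  - move=> t; rewrite /= in_itv/= => /andP[xt ty].
    apply: le_trans (ler_normD _ _) _; rewrite !normrM lerD//.
      rewrite mulrC ler_wpM2r//; exact: (Dg x t y y).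
    rewrite ler_pM//; first by rewrite distrC; exact: (Df x x t y).
    apply: vM; rewrite /= in_itv/= (le_trans ax xt); exact: le_trans yb.
rewrite RintegralD//; last exact: intg_cst.
rewrite RintegralZl//; last exact: wn.
rewrite Rintegral_itv_cst// -/(W x y) le_eqVlt; apply/orP; left; apply/eqP; ring.
Qed.

(** The bounds given by [test_function] may come in the wrong order and say nothing about the values
    at the endpoints. Enlarging the interval on both sides makes eta vanish at its ends, and outside
    it eta vanishes on a neighbourhood, so that its derivative vanishes too. *)
Lemma test_functionP (eta : R -> R) : test_function eta ->
  [/\ forall x, is_derive x (1 : R) eta (derive1 eta x),
      cont_pos (derive1 eta) &
      exists a b, [/\ 0 < a, a <= b, eta a = 0, eta b = 0 &
        forall x, ~ `[a, b]%classic x -> eta x = 0 /\ derive1 eta x = 0]].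
Proof.
move=> [eta_smooth [a0 [b0 [a00 eta_supp]]]]; split.
- by move=> x; apply: DeriveDef; [exact: (eta_smooth 0%N)|rewrite derive1E].
- move=> x _; apply/differentiable_continuous/derivable1_diffP.
  exact: (eta_smooth 1%N).
have eta_out x : x < a0 \/ b0 < x -> eta x = 0.
  move=> N; apply/eqP/negPn/negP => /eta_supp/andP[].
  by case: N => h; [rewrite leNgt h|move=> _; rewrite leNgt h].
have aa0 : a0 / 2 < a0 by rewrite ltr_pdivrMr// ltr_pMr// ltr1n.
have b0b : b0 < Num.max a0 b0 + 1.
  by rewrite (@le_lt_trans _ _ (Num.max a0 b0)) ?ltrDl// le_max lexx orbT.
exists (a0 / 2), (Num.max a0 b0 + 1); split.
- by rewrite divr_gt0.
- by rewrite (le_trans (ltW aa0))// (@le_trans _ _ (Num.max a0 b0)) ?lerDl// le_max lexx.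
- by apply: eta_out; left.
- by apply: eta_out; right.
move=> x; rewrite /= in_itv/= => /negP; rewrite negb_and -!ltNge => N.
have {}N : x < a0 \/ b0 < x.
  by case/orP: N => h; [left; exact: lt_trans aa0|right; exact: lt_trans h].
split; first exact: eta_out.
have : is_derive x (1 : R) eta 0.
  apply: (@near_eq_is_derive _ _ _ (cst 0)).
  case: N => h; near=> y; rewrite eta_out//; [left|right]; near: y.
    exact: lt_nbhsl.
  exact: lt_nbhsr.
by move=> ?; rewrite derive1E derive_val.
Unshelve. all: by end_near. Qed.

(** The Leibniz formula on an interval containing the support: the boundary terms are 0 because eta
    vanishes at both ends. *)
Lemma ac_integration_by_parts f w (eta : R -> R) : ac f w -> test_function eta ->
  \int[mu]_(x in Rplus) (f x * derive1 eta x) =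
  - \int[mu]_(x in Rplus) (w x * eta x).
Proof.
move=> H /test_functionP[d1 d2 [a [b [a0 ab ea eb out]]]].
have K := C1_ac (fun x _ => d1 x) d2.
have [_] := acM H K d2 a0 ab.
rewrite ea eb !mulr0 subr0 RintegralD//; last 2 first.
- have [wi _] := H a b a0 ab.
  have [M _ M1] := cont_pos_bounded a0 ab (ac_cont K).
  by apply: (intg_bounded _ wi _ M1) => //; exact: cont_pos_measurable_seg (ac_cont K).
- by apply: cont_pos_intg => //; apply: cont_posM => //; exact: ac_cont H.
move/esym/eqP; rewrite addrC addr_eq0 => /eqP E.
rewrite (@Rintegral_supp _ _ `[a, b]%classic); first last.
- by move=> x _ /out[_ ->]; rewrite mulr0.
- exact: segment_Rplus.
rewrite [in RHS](@Rintegral_supp _ _ `[a, b]%classic)//.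
- exact: segment_Rplus.
- by move=> x _ /out[-> _]; rewrite mulr0.
Qed.

End AbsolutelyContinuous.

(** * The fundamental lemma of the calculus of variations *)

Section FundamentalLemma.
Context {R : realType}.
Notation mu := (@lebesgue_measure R).
Implicit Types (f g v w : R -> R) (a b x y : R).

Lemma intg_supp (D E : set (measurableTypeR R)) f :
  measurable D -> measurable E -> E `<=` D ->
  (forall x, D x -> ~ E x -> f x = 0) -> intg E f -> intg D f.
Proof.
move=> mD mE ED f0 /(integrable_mkcond _ mE) H.
apply/(integrable_mkcond _ mD).
rewrite (_ : _ \_ D = (EFin \o f) \_ E)//; apply/funext => x; rewrite !patchE.
case: ifPn => [|] xD; case: ifPn => [|] xE //.
- by rewrite /= f0//; [exact: set_mem|move/mem_set; apply/negP].
- by move: xE xD => /set_mem/ED/mem_set ->.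
Qed.

Lemma locally_integrable_segment w a b : locally_integrable Rplus w -> 0 < a -> intg `[a, b] w.
Proof.
move=> [mw _ wi] a0; apply/integrableP; split.
  apply/measurable_EFinP; apply: measurable_funS mw; last exact: segment_Rplus.
  exact: measurable_Rplus.
by apply: wi; [exact: segment_Rplus|exact: segment_compact].
Qed.

Lemma intgM_test w (eta : R -> R) : locally_integrable Rplus w -> test_function eta ->
  intg Rplus (fun x => w x * eta x).
Proof.
move=> wi /test_functionP[d1 _ [a [b [a0 ab ea eb out]]]].
have ce : cont_pos eta by move=> x _; exact: is_derive_cont (d1 x).
apply: (@intg_supp _ `[a, b]) => //; first exact: measurable_Rplus.
- exact: segment_Rplus.
- by move=> x _ /out[-> _]; rewrite mulr0.
have [M _ M1] := cont_pos_bounded a0 ab ce.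
apply: (intg_bounded _ _ _ M1) => //; first exact: locally_integrable_segment.
exact: cont_pos_measurable_seg.
Qed.

(** Dominated convergence along the bumps, which lie between 0 and 1, so that |w| dominates. The
    limit is the integral over the open interval, which differs from the closed one by a null
    set. *)
Lemma integral_eq0_of_test w a b : locally_integrable Rplus w ->
  (forall eta, test_function eta -> \int[mu]_(x in Rplus) (w x * eta x) = 0) ->
  0 < a -> \int[mu]_(x in `[a, b]) w x = 0.
Proof.
move=> wi w0 a0.
have wab := locally_integrable_segment b wi a0.
have mw := intg_measurable wab.
have mb n : measurable_fun (`[a, b] : set (measurableTypeR R)) (bump a b n.+1%:R).
  apply: cont_pos_measurable_seg => // x _.
  by apply/differentiable_continuous/derivable1_diffP; exact: (@bump_derivable _ a b _ 0 x).
have test0 n : (\int[mu]_(x in `[a, b]) (w x * bump a b n.+1%:R x)%:E = 0)%E.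
  have tb : test_function (bump a b n.+1%:R) by apply: bump_test_function; rewrite ?ltr0n.
  have := w0 _ tb; rewrite (@Rintegral_supp _ _ `[a, b]%classic); first last.
  - move=> x _ xab; suff -> : bump a b n.+1%:R x = 0 by rewrite mulr0.
    apply/eqP/negPn/negP => /bump_itv => /(_ (ltr0Sn _ _)) H; apply: xab.
    by rewrite /= in_itv.
  - exact: segment_Rplus.
  rewrite /Rintegral => E.
  (* [fine] also sends the infinite values to 0, so the extended integral is 0 only once it is known
     to be finite. *)
  rewrite -[LHS]fineK ?E//; apply: integrable_fin_num => //.
  apply: (@intg_bounded _ _ _ _ 1) => // x _.
  by have /andP[? ?] := bump_ge0_le1 a b n.+1%:R x; rewrite ger0_norm.
have cvg_ae : {ae mu, forall x, `[a, b]%classic x ->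
    ((w x * bump a b n.+1%:R x)%:E @[n --> \oo] --> (w x * \1_(`]a, b[%classic) x)%:E)%E}.
  apply: aeW => x _; apply: cvg_EFin; first exact: nearW.
  by apply: cvgM; [exact: cvg_cst|exact: bump_cvg].
have dom_ae : {ae mu, forall x n, `[a, b]%classic x ->
    (`|(w x * bump a b n.+1%:R x)%:E| <= `|w x|%:E)%E}.
  apply: aeW => x n _; rewrite /= lee_fin normrM ler_piMr//.
  by have /andP[? ?] := bump_ge0_le1 a b n.+1%:R x; rewrite ger0_norm.
have mf n : measurable_fun (`[a, b] : set (measurableTypeR R))
    (fun x => (w x * bump a b n.+1%:R x)%:E).
  by apply/measurable_EFinP; exact: measurable_funM.
have mg : measurable_fun (`[a, b] : set (measurableTypeR R))
    (fun x => (w x * \1_(`]a, b[%classic) x)%:E).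
  apply/measurable_EFinP; apply: measurable_funM => //.
have [_ _ L] := @dominated_convergence _ _ _ mu (`[a, b] : set (measurableTypeR R))
  (measurable_itv _) _ _ _ mf mg cvg_ae (integrable_norm wab) dom_ae.
have {}L : (0%E = \int[mu]_(x in `[a, b]) (w x * \1_(`]a, b[%classic) x)%:E)%E.
  apply: (cvg_unique (@ereal_hausdorff R) _ L).
  by rewrite (_ : (fun _ => _) = fun=> 0%E);
    [exact: cvg_cst|apply/funext => n; rewrite test0].
(* No order of a and b is assumed; for b <= a the segment is empty or a single point. *)
have [ba|ab] := leP b a.
  by move: ba; rewrite le_eqVlt => /predU1P[->|ba];
    [rewrite set_itv1 Rintegral_set1|rewrite set_itv_ge ?Rintegral_set0// bnd_simp -ltNge].
rewrite -Rintegral_itv_obnd_cbnd; last first.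
  by apply: intgS wab => //; apply: subset_itvr; rewrite bnd_simp.
rewrite -Rintegral_itv_bndo_bndc; last first.
  by apply: intgS wab => //; apply: subset_itv; rewrite bnd_simp.
rewrite /Rintegral -[RHS]/(fine 0%E) L; congr fine.
rewrite [LHS]integral_mkcond [RHS]integral_mkcond; apply: eq_integral => x _.
rewrite !patchE indicE; case: ifPn => xo.
  by rewrite mulr1 mem_set//; apply: subset_itv_oo_cc; exact: set_mem.
by case: ifPn => //; rewrite mulr0.
Qed.

(** By Lebesgue differentiation w is almost everywhere the derivative of its primitive, and that
    primitive is identically 0 by [integral_eq0_of_test]. This is done on the intervals ]1/(n+1),
    n+1[, a countable family that exhausts the half-line. *)
Lemma ae_eq0_of_test w : locally_integrable Rplus w ->
  (forall eta, test_function eta -> \int[mu]_(x in Rplus) (w x * eta x) = 0) ->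
  {ae mu, forall x, Rplus x -> w x = 0}.
Proof.
move=> wi w0.
have H n : {ae mu, forall x, n.+1%:R^-1 < x < n.+1%:R -> w x = 0}.
  set c : R := n.+1%:R^-1; set d : R := n.+1%:R.
  have c0 : 0 < c by rewrite invr_gt0.
  have wcd := locally_integrable_segment d wi c0.
  (* w need not be integrable near 0 or at infinity; cut off outside [c, d] it is locally integrable
     on the whole line, as [FTC1] requires. *)
  have iW y : intg `[c, y] (w \_ `[c, d]).
    apply: (@intgS _ setT) => //; apply: (@intg_supp _ `[c, d]%classic) => //.
      by move=> x _ xcd; rewrite patchE memNset.
    by apply: intg_eq wcd => // x xcd; rewrite patchE mem_set.
  have lW : locally_integrable setT (w \_ `[c, d]).
    exact: integrable_locally_restrict.
  have := FTC1 iW lW.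
  apply: (@filterS _ _ (ae_filter_ringOfSetsType mu)) => x + /andP[cx xd].
  rewrite /= lte_fin cx => /(_ isT)[_].
  rewrite [in X in _ = X -> _]patchE mem_set; last by rewrite /= in_itv/= !ltW.
  move=> <-; rewrite derive1E.
  rewrite (@near_eq_derive _ _ _ _ (cst 0)) ?derive_cst//.
  near=> y; have yd : y < d by near: y; exact: lt_nbhsl.
  rewrite /cst -[RHS](@integral_eq0_of_test w c y)//; apply: Rintegral_eq => t.
  rewrite /= in_itv/= => /andP[ct ty].
  by rewrite patchE mem_set//= in_itv/= ct (le_trans ty (ltW yd)).
have {}H := ae_foralln H.
apply: (@filterS _ _ (ae_filter_ringOfSetsType mu) _ _ _ H) => x Hx.
rewrite /Rplus/= => x0.
(* An n above both x and 1 / x puts x into ]1/(n+1), n+1[. *)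
pose n := Num.bound (x + x^-1).
have xn : x + x^-1 < n%:R by apply: archi_boundP; apply: addr_ge0; rewrite ?invr_ge0 ltW.
have xV0 : 0 < x^-1 by rewrite invr_gt0.
have nn1 : n%:R <= n.+1%:R :> R by rewrite ler_nat.
apply: (Hx n); apply/andP; split.
  rewrite -[ltRHS]invrK ltf_pV2 ?posrE ?ltr0n//.
  by apply: lt_le_trans nn1; apply: le_lt_trans xn; rewrite lerDr ltW.
by apply: lt_le_trans nn1; apply: le_lt_trans xn; rewrite lerDl ltW.
Unshelve. all: by end_near. Qed.

End FundamentalLemma.

(** * Weak derivatives *)

Section ComplexParts.
Context {R : realType}.
Implicit Types (u v w : R -> R[i]) (r : R -> R) (x : R).

Lemma ReFD u v x : ReF (fun y => u y + v y) x = ReF u x + ReF v x.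
Proof. by rewrite /ReF; case: (u x) (v x) => [? ?] []. Qed.

Lemma ImFD u v x : ImF (fun y => u y + v y) x = ImF u x + ImF v x.
Proof. by rewrite /ImF; case: (u x) (v x) => [? ?] []. Qed.

Lemma ReFN u x : ReF (fun y => - u y) x = - ReF u x.
Proof. by rewrite /ReF; case: (u x). Qed.

Lemma ImFN u x : ImF (fun y => - u y) x = - ImF u x.
Proof. by rewrite /ImF; case: (u x). Qed.

Lemma ReFM u v x : ReF (fun y => u y * v y) x = ReF u x * ReF v x - ImF u x * ImF v x.
Proof. by rewrite /ReF /ImF; case: (u x) (v x) => [? ?] []. Qed.

Lemma ImFM u v x : ImF (fun y => u y * v y) x = ReF u x * ImF v x + ImF u x * ReF v x.
Proof. by rewrite /ReF /ImF; case: (u x) (v x) => [? ?] [? ?] /=. Qed.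

Lemma ReFMr r u x : ReF (fun y => u y * (r y)%:C) x = ReF u x * r x.
Proof. by rewrite ReFM /ReF /ImF /= mulr0 subr0. Qed.

Lemma ImFMr r u x : ImF (fun y => u y * (r y)%:C) x = ImF u x * r x.
Proof. by rewrite ImFM /ReF /ImF /= mulr0 add0r. Qed.

Lemma CintegralMr (D : set R) u r : Cintegral D (fun x => u x * (r x)%:C) =
  (\int[lebesgue_measure]_(x in D) (ReF u x * r x)) +i*
  (\int[lebesgue_measure]_(x in D) (ImF u x * r x)).
Proof.
by rewrite /Cintegral; congr Complex; apply: Rintegral_eq => x _;
  [exact: ReFMr|exact: ImFMr].
Qed.

Lemma complex_ext (a b : R[i]) :
  complex.Re a = complex.Re b -> complex.Im a = complex.Im b -> a = b.
Proof. by case: a b => [? ?] [? ?] /= -> ->. Qed.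

End ComplexParts.

(** * Uniqueness of weak derivatives and the choice made in [calA] *)

Section WeakDerivative.
Context {R : realType}.
Notation mu := (@lebesgue_measure R).
Implicit Types (u v w : R -> R[i]) (p : R -> R) (x : R).

(** A compact K is bounded, and so is its image under the inverse, which is continuous on K; the
    second bound keeps K away from 0. *)
Lemma compact_Rplus_segment (K : set R) : compact K -> K `<=` Rplus ->
  exists a b, [/\ 0 < a, a <= b & K `<=` `[a, b]].
Proof.
move=> cK K0.
have [M [_ HM]] := compact_bounded cK.
have cV : {within K, continuous (fun x : R => x^-1)}.
  apply: continuous_in_subspaceT => x; rewrite inE => /K0 x0.
  by apply: inv_continuous; rewrite gt_eqF.
have [N [_ HN]] := compact_bounded (continuous_compact cV cK).
(* The summand N1^-1 in M1 orders the endpoints even when K is empty. *)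
pose N1 := `|N| + 1; pose M1 := `|M| + 1 + N1^-1.
have N1N : N < N1 by rewrite (le_lt_trans (ler_norm _))// ltrDl.
have N10 : 0 < N1 by rewrite ltr_wpDl.
have M1M : M < M1.
  by rewrite (le_lt_trans (ler_norm _))// /M1 -addrA ltrDl addr_gt0// invr_gt0.
exists N1^-1, M1; split; first by rewrite invr_gt0.
  by rewrite /M1 lerDr addr_ge0.
move=> x Kx; have x0 : 0 < x := K0 _ Kx; rewrite /= in_itv/=; apply/andP; split.
  rewrite -[leRHS]invrK lef_pV2 ?posrE ?invr_gt0//.
  by rewrite (le_trans (ler_norm _))//; apply: (HN _ N1N); exists x.
by rewrite (le_trans (ler_norm _))//; apply: (HM _ M1M).
Qed.

Lemma segment_locally_integrable (w : R -> R) : measurable_fun Rplus w ->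
  (forall a b, 0 < a -> a <= b -> intg `[a, b] w) -> locally_integrable Rplus w.
Proof.
move=> mw wi; split; [exact: mw|exact: open_Rplus|].
move=> K K0 cK; have [a [b [a0 ab Kab]]] := compact_Rplus_segment cK K0.
have := wi a b a0 ab; move=> /(intgS (measurable_itv _) (compact_measurable cK) Kab).
by move/integrableP => [].
Qed.

Lemma cont_pos_locally_integrable (f : R -> R) : cont_pos f -> locally_integrable Rplus f.
Proof.
move=> cf; apply: segment_locally_integrable; first exact: cont_pos_measurable.
by move=> *; exact: cont_pos_intg.
Qed.

Definition cac u w := ac (ReF u) (ReF w) /\ ac (ImF u) (ImF w).

Lemma cac_weak u w : cac u w -> Cmeasurable Rplus w -> is_weak_derivative u w.
Proof.
move=> [ru iu] [mr mi]; split.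
- by split; apply: cont_pos_locally_integrable; [exact: ac_cont ru|exact: ac_cont iu].
- split; apply: segment_locally_integrable => // a b a0 ab; first by have [] := ru a b a0 ab.
  by have [] := iu a b a0 ab.
- move=> eta te; rewrite !CintegralMr.
  by rewrite (ac_integration_by_parts ru te) (ac_integration_by_parts iu te).
Qed.

Lemma weak_derivative_unique u v w :
  is_weak_derivative u v -> is_weak_derivative u w -> eq_aeRplus v w.
Proof.
move=> [_ [vr vi] Hv] [_ [wr wi] Hw].
have H eta : test_function eta ->
    Cintegral Rplus (fun x => v x * (eta x)%:C) =
    Cintegral Rplus (fun x => w x * (eta x)%:C).
  by move=> te; apply: oppr_inj; rewrite -Hv// -Hw.
have Er : {ae mu, forall x, Rplus x -> ReF v x - ReF w x = 0}.
  apply: (@ae_eq0_of_test _ (fun x => ReF v x - ReF w x)); first exact: locally_integrableB.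
  move=> eta te; have := H eta te; rewrite !CintegralMr => -[E _].
  under Rintegral_eq do rewrite mulrBl.
  by rewrite RintegralB ?E ?subrr//;
    [exact: measurable_Rplus|exact: intgM_test|exact: intgM_test].
have Ei : {ae mu, forall x, Rplus x -> ImF v x - ImF w x = 0}.
  apply: (@ae_eq0_of_test _ (fun x => ImF v x - ImF w x)); first exact: locally_integrableB.
  move=> eta te; have := H eta te; rewrite !CintegralMr => -[_ E].
  under Rintegral_eq do rewrite mulrBl.
  by rewrite RintegralB ?E ?subrr//;
    [exact: measurable_Rplus|exact: intgM_test|exact: intgM_test].
apply: (@filterS2 _ _ (ae_filter_ringOfSetsType mu) _ _ _ _ Er Ei) => x Hr Hi x0.
by apply: complex_ext; apply/eqP; rewrite -subr_eq0; apply/eqP; [exact: Hr|exact: Hi].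
Qed.

Lemma eq_aeRplus_sym u v : eq_aeRplus u v -> eq_aeRplus v u.
Proof. by apply: (@filterS _ _ (ae_filter_ringOfSetsType mu)) => x H /H. Qed.

Lemma ae_Rintegral (D : set (measurableTypeR R)) (f g : R -> R) : measurable D ->
  measurable_fun D f -> measurable_fun D g ->
  {ae mu, forall x, D x -> f x = g x} ->
  \int[mu]_(x in D) f x = \int[mu]_(x in D) g x.
Proof.
move=> mD mf mg fg; congr fine; apply: ae_eq_integral => //;
  [exact/measurable_EFinP|exact/measurable_EFinP|].
by apply: (@filterS _ _ (ae_filter_ringOfSetsType mu) _ _ _ fg) => x H Dx; rewrite H.
Qed.

Lemma ae_locally_integrable (f g : R -> R) : measurable_fun Rplus g ->
  {ae mu, forall x, Rplus x -> f x = g x} ->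
  locally_integrable Rplus f -> locally_integrable Rplus g.
Proof.
move=> mg fg [mf oP fi]; split => // K K0 cK.
have mK := compact_measurable cK.
have mP := @measurable_Rplus R.
rewrite (_ : (\int[mu]_(x in K) `|g x|%:E = \int[mu]_(x in K) `|f x|%:E)%E); first exact: fi.
apply: ae_eq_integral => //.
- by apply/measurable_EFinP; apply: measurableT_comp => //; exact: measurable_funS mg.
- by apply/measurable_EFinP; apply: measurableT_comp => //; exact: measurable_funS mf.
- by apply: (@filterS _ _ (ae_filter_ringOfSetsType mu) _ _ _ fg) => x H /K0 /H ->.
Qed.

Lemma eq_aeRplus_Re u v : eq_aeRplus u v -> {ae mu, forall x, Rplus x -> ReF u x = ReF v x}.
Proof. by apply: (@filterS _ _ (ae_filter_ringOfSetsType mu)) => x H /H; rewrite /ReF => ->. Qed.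

Lemma eq_aeRplus_Im u v : eq_aeRplus u v -> {ae mu, forall x, Rplus x -> ImF u x = ImF v x}.
Proof. by apply: (@filterS _ _ (ae_filter_ringOfSetsType mu)) => x H /H; rewrite /ImF => ->. Qed.

Lemma is_weak_derivative_ae u v w : Cmeasurable Rplus v -> eq_aeRplus u v ->
  is_weak_derivative u w -> is_weak_derivative v w.
Proof.
move=> [mvr mvi] uv [[ur ui] wi H].
have mP := @measurable_Rplus R.
have uvr := eq_aeRplus_Re uv; have uvi := eq_aeRplus_Im uv.
split => //.
  by split; [exact: ae_locally_integrable ur|exact: ae_locally_integrable ui].
move=> eta te; rewrite -H// !CintegralMr.
have me : measurable_fun (Rplus : set (measurableTypeR R)) (derive1 eta).
  by have [_ ce _] := test_functionP te; exact: cont_pos_measurable.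
have [mur _ _] := ur; have [mui _ _] := ui.
congr Complex; apply: ae_Rintegral => //.
- exact: measurable_funM.
- exact: measurable_funM.
- by apply: (@filterS _ _ (ae_filter_ringOfSetsType mu) _ _ _ uvr) => x E /E ->.
- exact: measurable_funM.
- exact: measurable_funM.
- by apply: (@filterS _ _ (ae_filter_ringOfSetsType mu) _ _ _ uvi) => x E /E ->.
Qed.

Lemma weak_derivativeP u w : is_weak_derivative u w ->
  is_weak_derivative u (weak_derivative u).
Proof. by move=> H; apply: (@xgetPex _ (cst 0) [set v | is_weak_derivative u v]); exists w. Qed.

Lemma CmeasurableD D u v : Cmeasurable D u -> Cmeasurable D v ->
  Cmeasurable D (fun x => u x + v x).
Proof.
move=> [ur ui] [vr vi]; split.
  by rewrite (_ : ReF _ = fun x => ReF u x + ReF v x);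
    [exact: measurable_funD|apply/funext => x; exact: ReFD].
by rewrite (_ : ImF _ = fun x => ImF u x + ImF v x);
  [exact: measurable_funD|apply/funext => x; exact: ImFD].
Qed.

Lemma CmeasurableM D u v : Cmeasurable D u -> Cmeasurable D v ->
  Cmeasurable D (fun x => u x * v x).
Proof.
move=> [ur ui] [vr vi]; split.
  rewrite (_ : ReF _ = fun x => ReF u x * ReF v x - ImF u x * ImF v x);
    last by apply/funext => x; exact: ReFM.
  by apply: measurable_funB; exact: measurable_funM.
rewrite (_ : ImF _ = fun x => ReF u x * ImF v x + ImF u x * ReF v x);
  last by apply/funext => x; exact: ImFM.
by apply: measurable_funD; exact: measurable_funM.
Qed.

Lemma CmeasurableN D u : Cmeasurable D u -> Cmeasurable D (fun x => - u x).
Proof.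
move=> [ur ui]; split.
  by rewrite (_ : ReF _ = fun x => - ReF u x);
    [exact: measurable_funN|apply/funext => x; exact: ReFN].
by rewrite (_ : ImF _ = fun x => - ImF u x);
  [exact: measurable_funN|apply/funext => x; exact: ImFN].
Qed.

Lemma Cmeasurable_real (r : R -> R) D : measurable_fun D r -> Cmeasurable D (fun x => (r x)%:C).
Proof. by move=> mr; split=> //; exact: measurable_cst. Qed.

Lemma weak_derivative_measurable u w : is_weak_derivative u w ->
  Cmeasurable Rplus (weak_derivative u).
Proof. by move=> /weak_derivativeP[_ [[? _ _] [? _ _]] _]. Qed.

(** [calA] makes two nested choices. The inner one agrees with v only almost everywhere, so the weak
    derivative g of p v is first transferred to p times the chosen representative; uniqueness then
    identifies the outer choice with g. Measurability is recorded separately, since membership in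
    L^2 asks for it and an equality almost everywhere does not provide it. *)
Lemma calA_eq_ae p q u v g : cont_pos p -> cont_pos q ->
  cac u v -> cac (fun x => (p x)%:C * v x) g ->
  Cmeasurable Rplus v -> Cmeasurable Rplus g ->
  Cmeasurable Rplus (calA p q u) /\
  eq_aeRplus (calA p q u) (fun x => - g x + (q x)%:C * u x).
Proof.
move=> cp cq uv pvg mv mg.
have Wu := cac_weak uv mv.
have Wv : eq_aeRplus v (weak_derivative u).
  exact: weak_derivative_unique Wu (weak_derivativeP Wu).
have Mp : Cmeasurable Rplus (fun x => (p x)%:C).
  exact: Cmeasurable_real (cont_pos_measurable cp).
have Wp : is_weak_derivative (fun x => (p x)%:C * weak_derivative u x) g.
  apply: is_weak_derivative_ae (cac_weak pvg mg).
    by apply: CmeasurableM => //; exact: weak_derivative_measurable Wu.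
  by apply: (@filterS _ _ (ae_filter_ringOfSetsType mu) _ _ _ Wv) => x E /E ->.
split.
  apply: CmeasurableD.
    by apply: CmeasurableN; exact: weak_derivative_measurable Wp.
  apply: CmeasurableM; first exact: Cmeasurable_real (cont_pos_measurable cq).
  case: uv => /ac_cont ur /ac_cont ui.
  by split; exact: cont_pos_measurable.
have := weak_derivative_unique Wp (weak_derivativeP Wp).
by apply: (@filterS _ _ (ae_filter_ringOfSetsType mu)) => x E /E Ex; rewrite /calA Ex.
Qed.

End WeakDerivative.

(** * Square-integrable functions *)

Section SquareIntegrable.
Context {R : realType}.
Notation mu := (@lebesgue_measure R).
Implicit Types (f g : R -> R) (u v h : R -> R[i]) (D E : set (measurableTypeR R)).

(** The squared modulus as an element of R: polynomial in the components, it avoids square roots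
    until [L2normE] relates it to the L^2 norm. *)
Definition sqnorm (z : R[i]) : R := complex.Re z ^+ 2 + complex.Im z ^+ 2.

Lemma sqnorm_ge0 z : 0 <= sqnorm z.
Proof. by rewrite addr_ge0// sqr_ge0. Qed.

Lemma sqnormM z1 z2 : sqnorm (z1 * z2) = sqnorm z1 * sqnorm z2.
Proof. by case: z1 z2 => [a b] [c d]; rewrite /sqnorm /=; ring. Qed.

Lemma sqnormD_le z1 z2 : sqnorm (z1 + z2) <= 2 * sqnorm z1 + 2 * sqnorm z2.
Proof.
case: z1 z2 => [a b] [c d]; rewrite /sqnorm /=.
have : 0 <= (a - c) ^+ 2 + (b - d) ^+ 2 by rewrite addr_ge0// sqr_ge0.
nra.
Qed.

Definition sqmod u x : R := sqnorm (u x).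

Lemma sqmodE u x : sqmod u x = ReF u x ^+ 2 + ImF u x ^+ 2.
Proof. by []. Qed.

Lemma sqmod_measurable D u : Cmeasurable D u -> measurable_fun D (sqmod u).
Proof.
move=> [mr mi]; apply: measurable_funD; first exact: measurable_funX.
exact: measurable_funX.
Qed.

Lemma L2normE D u : (L2norm D u = (\int[mu]_(x in D) (sqmod u x)%:E) `^ 2^-1)%E.
Proof.
rewrite /L2norm unlock /=; congr poweR.
rewrite [RHS]integral_mkcond; apply: eq_integral => x _; rewrite !patchE.
case: ifPn => _.
  rewrite /= ger0_norm; last by case: (u x) => a b; exact: sqrtr_ge0.
  rewrite (powR_mulrn 2); last by case: (u x) => a b; exact: sqrtr_ge0.
  rewrite /sqmod; case: (u x) => a b /=.
  by rewrite sqr_sqrtr// addr_ge0// sqr_ge0.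
by rewrite /point/= normr0 powR0.
Qed.

Lemma L2P D u : measurable D ->
  L2 D u <-> Cmeasurable D u /\ intg D (sqmod u).
Proof.
move=> mD; rewrite /L2/= L2normE.
have E : Cmeasurable D u ->
    (\int[mu]_(x in D) `|(sqmod u x)%:E| = \int[mu]_(x in D) (sqmod u x)%:E)%E.
  by move=> mu_; apply: eq_integral => x _; rewrite gee0_abs// lee_fin sqnorm_ge0.
split=> -[mu_].
  move=> /lty_poweRy => /(_ (lt0r_neq0 _)); rewrite invr_gt0 => /(_ (ltr0Sn _ _)) H.
  split => //; apply/integrableP; split; last by rewrite E.
  by apply/measurable_EFinP; exact: sqmod_measurable.
by move=> /integrableP[_ H]; split => //; rewrite E// in H; exact: poweR_lty.
Qed.

Lemma real_discriminant (a b c : R) : 0 <= a -> (forall t, 0 <= t ^+ 2 * a - 2 * t * c + b) ->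
  c ^+ 2 <= a * b.
Proof.
move=> a0 H; have b0 : 0 <= b by have := H 0; rewrite expr0n/= mulr0 !mul0r sub0r oppr0 add0r.
move: a0; rewrite le_eqVlt => /predU1P[a0|a0].
  have [->|c0] := eqVneq c 0; first by rewrite expr0n/= mulr_ge0// -a0.
  (* For a = 0 and c != 0 the expression is affine in t, and this t gives it the value -1. *)
  have := H ((b + 1) / (2 * c)); rewrite -a0 mulr0 sub0r.
  have -> : 2 * ((b + 1) / (2 * c)) * c = b + 1 by field.
  by rewrite opprD addrAC addNr sub0r oppr_ge0 ler10.
(* The minimizer of the quadratic. *)
have := H (c / a).
have -> : (c / a) ^+ 2 * a - 2 * (c / a) * c + b = (a * b - c ^+ 2) / a.
  by field; rewrite gt_eqF.
by rewrite pmulr_lge0 ?invr_gt0// subr_ge0.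
Qed.

(** Integrability follows from |f g| <= f^2 + g^2, the inequality from the discriminant of the
    nonnegative quadratic t -> int_D (t f - g)^2. Bounding by integrals over the larger set E makes
    the estimate uniform in D, which will be ]0, x] or [x, +oo[ with x varying. *)
Lemma cauchy_schwarz D E f g : measurable D -> measurable E -> D `<=` E ->
  measurable_fun E f -> measurable_fun E g ->
  intg E (fun x => f x ^+ 2) -> intg E (fun x => g x ^+ 2) ->
  intg D (fun x => f x * g x) /\
  (\int[mu]_(x in D) (f x * g x)) ^+ 2 <=
    (\int[mu]_(x in E) f x ^+ 2) * (\int[mu]_(x in E) g x ^+ 2).
Proof.
move=> mD mE DE mf mg f2 g2.
have f2D := intgS mE mD DE f2; have g2D := intgS mE mD DE g2.
have fgD : intg D (fun x => f x * g x).
  apply: (@intg_le _ _ _ (fun x => f x ^+ 2 + g x ^+ 2)) => //.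
  - by apply: measurable_funS DE _ => //; exact: measurable_funM.
  - move=> x _; rewrite normrM -(real_normK (num_real (f x))) -(real_normK (num_real (g x))).
    have := normr_ge0 (f x); have := normr_ge0 (g x).
    set a := `|f x|; set b := `|g x|; nra.
  - exact: intgD.
split=> //.
have le2 k : intg E (fun x => k x ^+ 2) ->
    \int[mu]_(x in D) k x ^+ 2 <= \int[mu]_(x in E) k x ^+ 2.
  move=> k2; rewrite /Rintegral fine_le//.
  - by apply: integrable_fin_num => //; exact: intgS k2.
  - exact: integrable_fin_num.
  - apply: ge0_subset_integral => //; first exact: (measurable_int mu).
    by move=> x _; rewrite lee_fin sqr_ge0.
have I0 k : 0 <= \int[mu]_(x in D) k x ^+ 2.
  by apply: Rintegral_ge0 => x _; exact: sqr_ge0.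
apply: (@le_trans _ _ ((\int[mu]_(x in D) f x ^+ 2) * (\int[mu]_(x in D) g x ^+ 2))); last first.
  by apply: ler_pM => //; exact: le2.
apply: real_discriminant => // t.
have : 0 <= \int[mu]_(x in D) ((t ^+ 2 * f x ^+ 2 - (2 * t) * (f x * g x)) + g x ^+ 2).
  apply: Rintegral_ge0 => x _.
  have -> : t ^+ 2 * f x ^+ 2 - 2 * t * (f x * g x) + g x ^+ 2 = (t * f x - g x) ^+ 2 by ring.
  exact: sqr_ge0.
rewrite RintegralD//; last by apply: intgB => //; exact: intgZ.
by rewrite RintegralB ?RintegralZl//; exact: intgZ.
Qed.

Definition Cintg D u := intg D (ReF u) /\ intg D (ImF u).

Lemma L2_parts D u : measurable D -> L2 D u ->
  [/\ intg D (fun x => ReF u x ^+ 2), intg D (fun x => ImF u x ^+ 2),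
    \int[mu]_(x in D) ReF u x ^+ 2 <= \int[mu]_(x in D) sqmod u x &
    \int[mu]_(x in D) ImF u x ^+ 2 <= \int[mu]_(x in D) sqmod u x].
Proof.
move=> mD /(L2P _ mD)[[mr mi] ui].
have ir : intg D (fun x => ReF u x ^+ 2).
  apply: intg_le ui => //; first exact: measurable_funX.
  by move=> x _; rewrite ger0_norm ?sqr_ge0// sqmodE lerDl sqr_ge0.
have ii : intg D (fun x => ImF u x ^+ 2).
  apply: intg_le ui => //; first exact: measurable_funX.
  by move=> x _; rewrite ger0_norm ?sqr_ge0// sqmodE lerDr sqr_ge0.
split => //; apply: le_Rintegral => // x _; rewrite sqmodE.
  by rewrite lerDl sqr_ge0.
by rewrite lerDr sqr_ge0.
Qed.

(** The real and the imaginary part are each a sum or difference of two real integrals, whose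
    squares are at most the product on the right. By (s + t)^2 <= 2 s^2 + 2 t^2 each part
    contributes at most 4 times this product, hence the factor 8. *)
Lemma Ccauchy_schwarz D E u h : measurable D -> measurable E -> D `<=` E ->
  L2 E u -> L2 E h ->
  Cintg D (fun x => u x * h x) /\
  sqnorm (Cintegral D (fun x => u x * h x)) <=
    8 * ((\int[mu]_(x in E) sqmod u x) * (\int[mu]_(x in E) sqmod h x)).
Proof.
move=> mD mE DE Lu Lh.
have [[mur mui] _] := Lu; have [[mhr mhi] _] := Lh.
have [ur2 ui2 urS uiS] := L2_parts mE Lu; have [hr2 hi2 hrS hiS] := L2_parts mE Lh.
set A := \int[mu]_(x in E) sqmod u x; set H := \int[mu]_(x in E) sqmod h x.
have I0 k : 0 <= \int[mu]_(x in E) k x ^+ 2.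
  by apply: Rintegral_ge0 => x _; exact: sqr_ge0.
have [rr rrS] := cauchy_schwarz mD mE DE mur mhr ur2 hr2.
have [ii iiS] := cauchy_schwarz mD mE DE mui mhi ui2 hi2.
have [ri riS] := cauchy_schwarz mD mE DE mur mhi ur2 hi2.
have [ir irS] := cauchy_schwarz mD mE DE mui mhr ui2 hr2.
have {}rrS := le_trans rrS (ler_pM (I0 _) (I0 _) urS hrS).
have {}iiS := le_trans iiS (ler_pM (I0 _) (I0 _) uiS hiS).
have {}riS := le_trans riS (ler_pM (I0 _) (I0 _) urS hiS).
have {}irS := le_trans irS (ler_pM (I0 _) (I0 _) uiS hrS).
split.
  split.
    apply: intg_eq (intgB mD rr ii) => // x _; by rewrite ReFM.
  by apply: intg_eq (intgD mD ri ir) => // x _; rewrite ImFM.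
rewrite /Cintegral /sqnorm/=.
under Rintegral_eq do rewrite ReFM.
under [X in _ + X ^+ 2]Rintegral_eq do rewrite ImFM.
rewrite RintegralB// RintegralD//.
move: rrS iiS riS irS; rewrite -/A -/H.
set a := Rintegral _ _ _; set b := Rintegral _ _ _.
set c := Rintegral _ _ _; set d := Rintegral _ _ _.
have := sqr_ge0 (a + b); have := sqr_ge0 (c - d); nra.
Qed.

Lemma L2M_bounded D u v (M : R) : measurable D -> L2 D u -> Cmeasurable D v ->
  (forall x, D x -> sqmod v x <= M) -> L2 D (fun x => v x * u x).
Proof.
move=> mD /(L2P _ mD)[mu_ ui] mv vM; apply/(L2P _ mD).
have m : Cmeasurable D (fun x => v x * u x) by exact: CmeasurableM.
split => //; apply: (@intg_le _ _ _ (fun x => M * sqmod u x)) => //.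
- exact: sqmod_measurable.
- move=> x Dx; rewrite ger0_norm ?sqnorm_ge0// /sqmod sqnormM ler_wpM2r ?sqnorm_ge0//.
  exact: vM.
- exact: intgZ.
Qed.

Lemma L2D D u v : measurable D -> L2 D u -> L2 D v -> L2 D (fun x => u x + v x).
Proof.
move=> mD /(L2P _ mD)[mu_ ui] /(L2P _ mD)[mv vi]; apply/(L2P _ mD).
have m : Cmeasurable D (fun x => u x + v x) by exact: CmeasurableD.
split => //; apply: (@intg_le _ _ _ (fun x => 2 * sqmod u x + 2 * sqmod v x)) => //.
- exact: sqmod_measurable.
- by move=> x Dx; rewrite ger0_norm ?sqnorm_ge0// /sqmod sqnormD_le.
- by apply: intgD => //; exact: intgZ.
Qed.

Lemma L2Z D (c : R[i]) u : measurable D -> L2 D u -> L2 D (fun x => c * u x).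
Proof.
move=> mD Lu; apply: (@L2M_bounded _ _ (fun=> c) (sqnorm c)) => //.
by split; exact: measurable_cst.
Qed.

Lemma L2S D E u : measurable D -> measurable E -> E `<=` D -> L2 D u -> L2 E u.
Proof.
move=> mD mE ED /(L2P _ mD)[[mr mi] ui]; apply/(L2P _ mE); split.
  by split; [exact: measurable_funS mr|exact: measurable_funS mi].
exact: intgS ui.
Qed.

Lemma L2_eq D u v : (forall x, D x -> u x = v x) -> measurable D -> L2 D u -> L2 D v.
Proof.
move=> uv mD /(L2P _ mD)[[mr mi] ui]; apply/(L2P _ mD); split.
  split.
    apply: (eq_measurable_fun (ReF u)) mr => x; rewrite inE /ReF => Dx.
    by rewrite uv.
  apply: (eq_measurable_fun (ImF u)) mi => x; rewrite inE /ImF => Dx.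
  by rewrite uv.
by apply: intg_eq ui => // x Dx; rewrite /sqmod uv.
Qed.

Lemma L2_ae D u v : measurable D -> Cmeasurable D v ->
  {ae mu, forall x, D x -> u x = v x} -> L2 D u -> L2 D v.
Proof.
move=> mD mv uv /(L2P _ mD)[mu_ ui]; apply/(L2P _ mD); split => //.
have ms := sqmod_measurable mv; have mt := sqmod_measurable mu_.
apply/integrableP; split; first exact/measurable_EFinP.
move/integrableP : ui => [_]; congr (_ < _)%E.
apply: ae_eq_integral => //.
- by apply/measurable_EFinP; apply: measurableT_comp.
- by apply/measurable_EFinP; apply: measurableT_comp.
- by apply: (@filterS _ _ (ae_filter_ringOfSetsType mu) _ _ _ uv)
    => x H /H; rewrite /sqmod/= => ->.
Qed.

Definition Ccont u := cont_pos (ReF u) /\ cont_pos (ImF u).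

Lemma Ccont_measurable u : Ccont u -> Cmeasurable Rplus u.
Proof. by move=> [ur ui]; split; exact: cont_pos_measurable. Qed.

Lemma Ccont_sqmod u : Ccont u -> cont_pos (sqmod u).
Proof. by move=> [ur ui]; apply: cont_posD; apply: cont_posM. Qed.

Lemma L2loc_mul_Ccont u v : L2loc u -> Ccont v -> L2loc (fun x => v x * u x).
Proof.
move=> Lu cv K cK K0; have [a [b [a0 ab Kab]]] := compact_Rplus_segment cK K0.
have mK := compact_measurable cK.
have [M _ HM] := cont_pos_bounded a0 ab (Ccont_sqmod cv).
apply: (@L2M_bounded _ _ _ M) => //; first exact: Lu.
- have [mr mi] := Ccont_measurable cv.
  by split; [exact: (measurable_funS measurable_Rplus K0 mr)|
             exact: (measurable_funS measurable_Rplus K0 mi)].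
- by move=> x /Kab/HM; exact: le_trans (ler_norm _).
Qed.

Lemma L2locD u v : L2loc u -> L2loc v -> L2loc (fun x => u x + v x).
Proof.
move=> Lu Lv K cK K0; have mK := compact_measurable cK.
by apply: L2D => //; [exact: Lu|exact: Lv].
Qed.

Lemma L2loc_cst (c : R[i]) : L2loc (fun=> c).
Proof.
move=> K cK K0; have [a [b [a0 ab Kab]]] := compact_Rplus_segment cK K0.
have mK := compact_measurable cK.
apply/(L2P _ mK); split; first by split; exact: measurable_cst.
by apply: intgS (intg_cst _ _ (sqnorm c)) => //; exact: Kab.
Qed.

Lemma L2loc_Ccont u : Ccont u -> L2loc u.
Proof.
move=> cu K cK K0; apply: L2_eq (L2loc_mul_Ccont (L2loc_cst 1) cu cK K0).
  by move=> x _; rewrite mulr1.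
exact: compact_measurable.
Qed.

Lemma L2_L2loc u : L2 Rplus u -> L2loc u.
Proof.
move=> Lu K cK K0; apply: L2S Lu => //; first exact: measurable_Rplus.
exact: compact_measurable.
Qed.

End SquareIntegrable.

(** * Complex-valued absolutely continuous functions and limits at zero *)

Section ComplexAC.
Context {R : realType}.
Notation mu := (@lebesgue_measure R).
Implicit Types (u v w g : R -> R[i]) (f r : R -> R) (x : R).

Lemma Re_eq u v : (forall x, 0 < x -> u x = v x) -> forall x, 0 < x -> ReF u x = ReF v x.
Proof. by move=> uv x x0; rewrite /ReF uv. Qed.

Lemma Im_eq u v : (forall x, 0 < x -> u x = v x) -> forall x, 0 < x -> ImF u x = ImF v x.
Proof. by move=> uv x x0; rewrite /ImF uv. Qed.

Lemma cac_eq u w v g : (forall x, 0 < x -> u x = v x) ->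
  (forall x, 0 < x -> w x = g x) -> cac u w -> cac v g.
Proof.
move=> uv wg [ru iu]; split; [apply: ac_eq ru|apply: ac_eq iu];
  by [exact: Re_eq|exact: Im_eq].
Qed.

Lemma cacD u w v g : cac u w -> cac v g ->
  cac (fun x => u x + v x) (fun x => w x + g x).
Proof.
move=> [ru iu] [rv iv]; split.
  by apply: ac_eq (acD ru rv) => x _; rewrite ReFD.
by apply: ac_eq (acD iu iv) => x _; rewrite ImFD.
Qed.

Lemma cacN u w : cac u w -> cac (fun x => - u x) (fun x => - w x).
Proof.
move=> [ru iu]; split.
  by apply: ac_eq (acN ru) => x _; rewrite ReFN.
by apply: ac_eq (acN iu) => x _; rewrite ImFN.
Qed.

Lemma cacM u w v g : cac u w -> cac v g -> Ccont g ->
  cac (fun x => u x * v x) (fun x => w x * v x + u x * g x).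
Proof.
move=> [ru iu] [rv iv] [rg ig]; split.
  apply: ac_eq (acB (acM ru rv rg) (acM iu iv ig)) => x _; first by rewrite ReFM.
  by rewrite ReFD !ReFM; ring.
apply: ac_eq (acD (acM ru iv ig) (acM iu rv rg)) => x _; first by rewrite ImFM.
by rewrite ImFD !ImFM; ring.
Qed.

Lemma cac_cst (c : R[i]) : cac (fun=> c) (fun=> 0).
Proof.
have H (k : R) : ac (fun=> k) (fun=> 0).
  move=> a b a0 ab; split; first exact: intg_cst.
  by rewrite subrr Rintegral_itv_cst// mul0r.
by split; exact: H.
Qed.

Lemma cac_Ccont u w : cac u w -> Ccont u.
Proof. by move=> [/ac_cont ? /ac_cont ?]. Qed.

Lemma Ccont_eq u v : (forall x, 0 < x -> u x = v x) -> Ccont u -> Ccont v.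
Proof.
by move=> uv [ru iu]; split; [apply: cont_pos_eq ru|apply: cont_pos_eq iu];
  [exact: Re_eq|exact: Im_eq].
Qed.

Lemma CcontD u v : Ccont u -> Ccont v -> Ccont (fun x => u x + v x).
Proof.
move=> [ru iu] [rv iv]; split.
  by apply: cont_pos_eq (cont_posD ru rv) => x _; rewrite ReFD.
by apply: cont_pos_eq (cont_posD iu iv) => x _; rewrite ImFD.
Qed.

Lemma CcontM u v : Ccont u -> Ccont v -> Ccont (fun x => u x * v x).
Proof.
move=> [ru iu] [rv iv]; split.
  by apply: cont_pos_eq (cont_posB (cont_posM ru rv) (cont_posM iu iv)) => x _; rewrite ReFM.
by apply: cont_pos_eq (cont_posD (cont_posM ru iv) (cont_posM iu rv)) => x _; rewrite ImFM.
Qed.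

Lemma Ccont_cst (c : R[i]) : Ccont (fun=> c).
Proof. exact: cac_Ccont (cac_cst c). Qed.

Lemma Ccont_real r : cont_pos r -> Ccont (fun x => (r x)%:C).
Proof. by move=> cr; split=> //; exact: cont_pos_cst. Qed.

Lemma derivable_is_derive f x : derivable f x 1 -> is_derive x (1 : R) f (derive1 f x).
Proof. by move=> df; apply: DeriveDef => //; rewrite derive1E. Qed.

Lemma Cderivable_cont u : (forall x, 0 < x -> Cderivable u x) -> Ccont u.
Proof.
move=> du; split=> x /du[dr di].
  exact: is_derive_cont (derivable_is_derive dr).
exact: is_derive_cont (derivable_is_derive di).
Qed.

Lemma Cderivable_cac u v : (forall x, 0 < x -> Cderivable u x) ->
  (forall x, 0 < x -> Cderive u x = v x) -> Ccont v -> cac u v.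
Proof.
move=> du uv [rv iv]; split; apply: C1_ac => // x x0; rewrite /ReF /ImF -uv//;
  by apply: derivable_is_derive; have [] := du x x0.
Qed.

Lemma cac_Cderive u v x : cac u v -> Ccont v -> 0 < x ->
  Cderivable u x /\ Cderive u x = v x.
Proof.
move=> [ru iu] [rv iv] x0.
have dr := ac_is_derive ru x0 (rv x x0).
have di := ac_is_derive iu x0 (iv x x0).
split; first by split; exact: ex_derive.
by apply: complex_ext; rewrite /Cderive /= derive1E derive_val.
Qed.

End ComplexAC.

(** * Limits at zero, primitives and tail integrals *)

Section LimitsAtZero.
Context {R : realType}.
Notation mu := (@lebesgue_measure R).
Implicit Types (u v w g : R -> R[i]) (f r : R -> R) (x : R) (l m : R[i]).

Lemma cvg_right0_eq f r (l : R) : (forall x, 0 < x -> f x = r x) ->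
  f x @[x --> 0^'+] --> l -> r x @[x --> 0^'+] --> l.
Proof.
move=> fr; apply: cvg_trans; apply: near_eq_cvg; near=> x.
by apply: fr; near: x; exact: nbhs_right_gt.
Unshelve. all: by end_near. Qed.

Lemma Ccvg_eq u v l : (forall x, 0 < x -> u x = v x) ->
  Ccvg_right0 u l -> Ccvg_right0 v l.
Proof.
by move=> uv [ur ui]; split; [apply: cvg_right0_eq ur|apply: cvg_right0_eq ui];
  [exact: Re_eq|exact: Im_eq].
Qed.

Lemma CcvgD u v l m : Ccvg_right0 u l -> Ccvg_right0 v m ->
  Ccvg_right0 (fun x => u x + v x) (l + m).
Proof.
case: l m => [l1 l2] [m1 m2] [ur ui] [vr vi]; split.
  by apply: cvg_right0_eq (cvgD ur vr) => x _; rewrite ReFD.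
by apply: cvg_right0_eq (cvgD ui vi) => x _; rewrite ImFD.
Qed.

Lemma CcvgM u v l m : Ccvg_right0 u l -> Ccvg_right0 v m ->
  Ccvg_right0 (fun x => u x * v x) (l * m).
Proof.
case: l m => [l1 l2] [m1 m2] [ur ui] [vr vi]; split.
  by apply: cvg_right0_eq (cvgB (cvgM ur vr) (cvgM ui vi)) => x _; rewrite ReFM.
by apply: cvg_right0_eq (cvgD (cvgM ur vi) (cvgM ui vr)) => x _; rewrite ImFM.
Qed.

Lemma Ccvg_cst l : Ccvg_right0 (fun=> l) l.
Proof. by split; exact: cvg_cst. Qed.

Lemma CcvgN u l : Ccvg_right0 u l -> Ccvg_right0 (fun x => - u x) (- l).
Proof.
move=> /(CcvgM (Ccvg_cst (-1))); rewrite mulN1r.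
by apply: Ccvg_eq => x _; rewrite mulN1r.
Qed.

Lemma Ccvg_real r (l : R) : r x @[x --> 0^'+] --> l ->
  Ccvg_right0 (fun x => (r x)%:C) l%:C.
Proof. by move=> rl; split=> //; exact: cvg_cst. Qed.

Lemma Ccvg_unique u l m : Ccvg_right0 u l -> Ccvg_right0 u m -> l = m.
Proof.
move=> [lr li] [mr mi]; apply: complex_ext.
  exact: (cvg_unique (@Rhausdorff R) lr mr).
exact: (cvg_unique (@Rhausdorff R) li mi).
Qed.

Lemma intg_oc_pos f x y : 0 <= x -> intg Rplus f -> intg `]x, y] f.
Proof.
move=> x0; apply: intgS => //; first exact: measurable_Rplus.
by move=> t /=; rewrite in_itv/= => /andP[/(le_lt_trans x0)].
Qed.

Lemma ac_prim0 f : intg Rplus f -> ac (fun x => \int[mu]_(t in `]0, x]) f t) f.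
Proof.
move=> fi a b a0 ab; split.
  by apply: intgS fi => //; [exact: measurable_Rplus|exact: segment_Rplus].
rewrite Rintegral_itvB ?bnd_simp ?(ltW a0)//; last exact: intg_oc_pos.
by apply: Rintegral_itv_obnd_cbnd; apply: intg_oc_pos => //; exact: ltW.
Qed.

(** Reduces the integral up to infinity to the primitive from 0: the density and the limit at 0 of
    the tail follow from those of the primitive. *)
Lemma Rintegral_tail f x : intg Rplus f -> 0 < x ->
  \int[mu]_(t in `[x, +oo[) f t =
  \int[mu]_(t in Rplus) f t - \int[mu]_(t in `]0, x]) f t.
Proof.
move=> fi x0; rewrite Rplus_itv Rintegral_itvB ?bnd_simp ?ltW//; last first.
  by rewrite -Rplus_itv.
rewrite Rintegral_itv_obnd_cbnd//; apply: intgS fi => //; first exact: measurable_Rplus.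
by move=> t /=; rewrite in_itv/= andbT; exact: lt_trans.
Qed.

Lemma prim0_cvg f : intg Rplus f ->
  \int[mu]_(t in `]0, x]) f t @[x --> 0^'+] --> (0 : R).
Proof.
move=> fi.
(* The value f 0 is arbitrary and lies outside the integrability assumption; extension by zero from
   the open half-line allows the closed interval [0, 1], where the primitive is continuous up to
   0. *)
have f1 : intg `[0, 1] (f \_ Rplus).
  apply: (@intg_supp _ _ `]0, 1]%classic) => //.
  - exact: subset_itv_oc_cc.
  - move=> x; rewrite /= !in_itv/= => /andP[x0 x1] /negP; rewrite x1 andbT => x0'.
    by rewrite patchE memNset//= => x00; rewrite x00 in x0'.
  - have := intg_oc_pos 1 (lexx 0) fi; apply: intg_eq => // x.
    by rewrite /= in_itv/= => /andP[x0 _]; rewrite patchE mem_set.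
have := parameterized_integral_cvg_left ltr01 f1.
move=> /cvg_at_right_filter; apply: cvg_right0_eq => x x0.
rewrite /parameterized_integral [LHS](@Rintegral_supp _ _ `]0, x]%classic).
- apply: eq_Rintegral => t; rewrite inE /= in_itv/= => /andP[t0 _].
  by rewrite patchE mem_set.
- exact: subset_itv_oc_cc.
- move=> t; rewrite /= !in_itv/= => /andP[t0 t1] /negP; rewrite t1 andbT => t0'.
  by rewrite patchE memNset//= => t00; rewrite t00 in t0'.
Qed.

Lemma cac_prim0 u : Cintg Rplus u -> cac (fun x => Cintegral `]0, x] u) u.
Proof. by move=> [ur ui]; split; exact: ac_prim0. Qed.

Lemma Cprim0_cvg u : Cintg Rplus u -> Ccvg_right0 (fun x => Cintegral `]0, x] u) 0.
Proof. by move=> [ur ui]; split; exact: prim0_cvg. Qed.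

Lemma Cintegral_tail u x : Cintg Rplus u -> 0 < x ->
  Cintegral `[x, +oo[ u = Cintegral Rplus u - Cintegral `]0, x] u.
Proof. by move=> [ur ui] x0; rewrite /Cintegral !Rintegral_tail. Qed.

Lemma cac_tail u : Cintg Rplus u -> cac (fun x => Cintegral `[x, +oo[ u) (fun x => - u x).
Proof.
move=> ui; apply: cac_eq (cacD (cac_cst (Cintegral Rplus u)) (cacN (cac_prim0 ui))) => x x0.
  by rewrite Cintegral_tail.
by rewrite add0r.
Qed.

Lemma Ctail_cvg u : Cintg Rplus u ->
  Ccvg_right0 (fun x => Cintegral `[x, +oo[ u) (Cintegral Rplus u).
Proof.
move=> ui; have := CcvgD (Ccvg_cst (Cintegral Rplus u)) (CcvgN (Cprim0_cvg ui)).
by rewrite subr0; apply: Ccvg_eq => x x0; rewrite Cintegral_tail.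
Qed.

Lemma Cintegral_lin (D : set (measurableTypeR R)) (c : R[i]) u v : measurable D ->
  Cintg D u -> Cintg D v ->
  Cintegral D (fun x => c * u x + v x) = c * Cintegral D u + Cintegral D v.
Proof.
move=> mD [ur ui] [vr vi]; case: c => a b.
rewrite /Cintegral; apply: complex_ext => /=.
  rewrite (_ : ReF _ = fun x => a * ReF u x - b * ImF u x + ReF v x); last first.
    by apply/funext => x; rewrite /ReF /ImF; case: (u x) (v x) => [? ?] [].
  rewrite RintegralD//; last by apply: intgB => //; exact: intgZ.
  by rewrite RintegralB ?RintegralZl//; exact: intgZ.
rewrite (_ : ImF _ = fun x => a * ImF u x + b * ReF u x + ImF v x); last first.
  by apply/funext => x; rewrite /ReF /ImF; case: (u x) (v x) => [? ?] [].
rewrite RintegralD//; last by apply: intgD => //; exact: intgZ.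
by rewrite RintegralD ?RintegralZl//; exact: intgZ.
Qed.

End LimitsAtZero.

(** * The resolvent *)

Section Solutions.
Context {R : realType}.
Notation mu := (@lebesgue_measure R).
Implicit Types (x y : R) (u h : R -> R[i]).
Variables (p q : R -> R) (p0 : R) (alpha : option R) (z : R[i]).
Variables (phi theta : R -> R[i]).
Hypotheses (p_C1 : C1_Rplus p) (q_C : cont_pos q) (p_lim : p x @[x --> 0^'+] --> p0).
Hypotheses (p_gt0 : forall x, Rplus x -> 0 < p x) (p0_gt0 : 0 < p0).
Hypotheses (phi_sol : is_solution p q z phi) (theta_sol : is_solution p q z theta).
Hypotheses (phi_init : phi_data alpha phi) (theta_init : theta_data p0 alpha theta).

Let pD x : 0 < x -> is_derive x (1 : R) p (derive1 p x).
Proof. by move=> x0; apply: derivable_is_derive; have [] := p_C1 x0. Qed.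

Let p_cont : cont_pos p.
Proof. by move=> x x0; exact: is_derive_cont (pD x0). Qed.

Let pV_cont : cont_pos (fun x => (p x)^-1).
Proof. by move=> x x0; apply: cvgV; [rewrite gt_eqF// p_gt0|exact: p_cont]. Qed.

Let pn0 x : 0 < x -> p x != 0.
Proof. by move=> x0; rewrite gt_eqF// p_gt0. Qed.

(** The quasi-derivative p u', in terms of which the equation reads (p u')' = (q - z) u. *)
Let quasi u x : R[i] := (p x)%:C * Cderive u x.

Let pVC x : 0 < x -> ((p x)^-1)%:C * (p x)%:C = 1 :> R[i].
Proof.
move=> x0; apply: complex_ext;
  by rewrite /= ?mulr0 ?mul0r ?subr0 ?addr0// mulVf// pn0. Qed.

(** The quasi-derivative is differentiable, hence continuous; dividing by p > 0 gives continuity of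
    u', and the equation itself gives that of (p u')'. All factors coming from a solution thus have
    continuous densities. *)
Lemma solution_cac u : is_solution p q z u ->
  [/\ cac u (Cderive u), Ccont (Cderive u),
      cac (quasi u) (fun x => ((q x)%:C - z) * u x)
    & Ccont (fun x => ((q x)%:C - z) * u x)].
Proof.
move=> us.
have cu : Ccont u by apply: Cderivable_cont => x /us[].
have cP : Ccont (quasi u) by apply: Cderivable_cont => x /us[].
have cd : Ccont (Cderive u).
  apply: Ccont_eq (CcontM (Ccont_real pV_cont) cP) => x x0.
  by rewrite mulrA pVC// mul1r.
have cq : Ccont (fun x => ((q x)%:C - z) * u x).
  by apply: CcontM => //; apply: CcontD; [exact: Ccont_real|exact: Ccont_cst].
split=> //.
  by apply: Cderivable_cac => // x /us[].
apply: Cderivable_cac => // x /us[_ _] E //.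
by rewrite mulrBl -E opprD opprK addrCA addrN addr0.
Qed.

Lemma wronskian x : 0 < x -> quasi theta x * phi x - quasi phi x * theta x = -1.
Proof.
have [cphi dphi cPphi qphi] := solution_cac phi_sol.
have [cthe dthe cPthe qthe] := solution_cac theta_sol.
(* Both solutions belong to the same z, so the terms (q - z) theta phi cancel, as do the terms p
   theta' phi'. *)
have H : cac (fun x => quasi theta x * phi x - quasi phi x * theta x) (fun=> 0).
  apply: cac_eq (cacD (cacM cPthe cphi dphi) (cacN (cacM cPphi cthe dthe))) => // y y0.
  by rewrite /quasi; ring.
have C s t : 0 < s -> s <= t ->
    quasi theta t * phi t - quasi phi t * theta t =
    quasi theta s * phi s - quasi phi s * theta s.
  move=> s0 st; have [Hr Hi] := H.
  have [_] := Hr s t s0 st; have [_] := Hi s t s0 st.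
  rewrite Rintegral_itv_cst// mul0r => Ei Er.
  by apply: complex_ext; apply/eqP; rewrite -subr_eq0; apply/eqP.
move=> x0.
have L1 : Ccvg_right0 (fun y => quasi theta y * phi y - quasi phi y * theta y)
   (quasi theta x * phi x - quasi phi x * theta x).
  apply: Ccvg_eq (Ccvg_cst _) => y y0.
  by have [/(C _ _ y0)|/ltW /(C _ _ x0)] := leP y x.
have pC := Ccvg_real p_lim.
have pp : p0%:C * (p0^-1)%:C = 1 :> R[i].
  by apply: complex_ext; rewrite /= ?mulr0 ?mul0r ?subr0 ?addr0// mulfV// gt_eqF.
suff L2 : Ccvg_right0 (fun y => quasi theta y * phi y - quasi phi y * theta y) (-1).
  exact: Ccvg_unique L1 L2.
(* For finite alpha the products p theta' phi and p phi' theta tend to -1 and 0; for alpha = oo they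
   tend to 0 and 1. The difference tends to -1 in both cases. *)
move: phi_init theta_init; rewrite /phi_data /theta_data.
case: alpha => [a|] [f0 f1] [t0 t1].
  have := CcvgD (CcvgM (CcvgM pC t1) f0) (CcvgN (CcvgM (CcvgM pC f1) t0)).
  by rewrite mulr0 oppr0 addr0 mulr1 rmorphN mulrN pp.
have := CcvgD (CcvgM (CcvgM pC t1) f0) (CcvgN (CcvgM (CcvgM pC f1) t0)).
by rewrite !mulr0 add0r mulr1 pp.
Qed.

(** * Regularity, bounds and boundary values of the resolvent *)

Hypotheses (phi_L2 : L2 Rplus phi) (theta_L2 : L2 Rplus theta).

(* T is R(z). *)
Let T h x : R[i] := theta x * Cintegral `]0, x] (fun y => phi y * h y)
  + phi x * Cintegral `[x, +oo[ (fun y => theta y * h y).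

Let mP := @measurable_Rplus R.

Lemma L2_mul_Cintg u h (D : set (measurableTypeR R)) : measurable D -> D `<=` Rplus ->
  L2 Rplus u -> L2 Rplus h -> Cintg D (fun y => u y * h y).
Proof. by move=> mD DP Lu Lh; have [] := Ccauchy_schwarz mD mP DP Lu Lh. Qed.

Let T1 h x : R[i] := Cderive theta x * Cintegral `]0, x] (fun y => phi y * h y)
  + Cderive phi x * Cintegral `[x, +oo[ (fun y => theta y * h y).

(** F and G are always the factor with a merely integrable density; the partner in [cacM] is a
    solution for the first derivative and a quasi-derivative for the second. Only in the latter case
    does h survive, multiplied by the Wronskian. *)
Lemma resolvent_cac h : L2 Rplus h ->
  [/\ cac (T h) (T1 h), Ccont (T1 h) &
    cac (fun x => (p x)%:C * T1 h x) (fun x => ((q x)%:C - z) * T h x - h x)].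
Proof.
move=> Lh.
have [cphi dphi cPphi qphi] := solution_cac phi_sol.
have [cthe dthe cPthe qthe] := solution_cac theta_sol.
have cF := cac_prim0 (L2_mul_Cintg mP (@subset_refl _ _) phi_L2 Lh).
have cG := cac_tail (L2_mul_Cintg mP (@subset_refl _ _) theta_L2 Lh).
split.
- apply: cac_eq (cacD (cacM cF cthe dthe) (cacM cG cphi dphi)) => x _.
    by rewrite /T; ring.
  by rewrite /T1; ring.
- by apply: CcontD; apply: CcontM => //; [exact: cac_Ccont cF|exact: cac_Ccont cG].
- apply: cac_eq (cacD (cacM cF cPthe qthe) (cacM cG cPphi qphi)) => x x0.
    by rewrite /T1 /quasi; ring.
  transitivity (((q x)%:C - z) * T h x
    + (quasi theta x * phi x - quasi phi x * theta x) * h x).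
    by rewrite /T; ring.
  by rewrite (wronskian x0) mulN1r.
Qed.

Lemma resolvent_bounded : exists M : R, forall h, L2 Rplus h ->
  L2 Rplus (T h) /\ (L2norm Rplus (T h) <= M%:E * L2norm Rplus h)%E.
Proof.
set A := \int[mu]_(x in Rplus) sqmod phi x; set B := \int[mu]_(x in Rplus) sqmod theta x.
have A0 : 0 <= A by apply: Rintegral_ge0 => x _; exact: sqnorm_ge0.
have B0 : 0 <= B by apply: Rintegral_ge0 => x _; exact: sqnorm_ge0.
(* Pointwise |T h|^2 is at most 2 |theta|^2 (8 A H) + 2 |phi|^2 (8 B H), with 8 from
   [Ccauchy_schwarz] and 2 from [sqnormD_le]. Integration over the half-line gives 32 A B H. *)
exists ((32 * A * B) `^ 2^-1) => h Lh.
set H := \int[mu]_(x in Rplus) sqmod h x.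
have H0 : 0 <= H by apply: Rintegral_ge0 => x _; exact: sqnorm_ge0.
have [/cac_Ccont/Ccont_measurable mT _ _] := resolvent_cac Lh.
have [mh ih] := (L2P _ mP).1 Lh.
have [_ iphi] := (L2P _ mP).1 phi_L2.
have [_ ithe] := (L2P _ mP).1 theta_L2.
pose bd x := (16 * A * H) * sqmod theta x + (16 * B * H) * sqmod phi x.
have ibd : intg Rplus bd by apply: intgD => //; exact: intgZ.
have Tbd x : Rplus x -> sqmod (T h) x <= bd x.
  move=> x0; rewrite /sqmod /T (le_trans (sqnormD_le _ _))// !sqnormM.
  have D1 : `]0, x]%classic `<=` (Rplus : set R).
    by move=> t; rewrite /= in_itv/= => /andP[].
  have D2 : `[x, +oo[%classic `<=` (Rplus : set R).
    by move=> t; rewrite /= in_itv/= andbT; exact: lt_le_trans.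
  have [_ E1] := Ccauchy_schwarz (measurable_itv `]0, x]) mP D1 phi_L2 Lh.
  have [_ E2] := Ccauchy_schwarz (measurable_itv `[x, +oo[) mP D2 theta_L2 Lh.
  have := ler_wpM2l (sqnorm_ge0 (theta x)) E1.
  have := ler_wpM2l (sqnorm_ge0 (phi x)) E2.
  rewrite /bd /sqmod -/A -/B -/H; lra.
have iT : intg Rplus (sqmod (T h)).
  apply: intg_le ibd => //; first exact: sqmod_measurable.
  by move=> x x0; rewrite ger0_norm ?sqnorm_ge0//; exact: Tbd.
have LT : L2 Rplus (T h) by apply/(L2P _ mP).
split=> //; rewrite !L2normE.
have fT (k : R -> R[i]) : intg Rplus (sqmod k) ->
    (\int[mu]_(x in Rplus) (sqmod k x)%:E = (\int[mu]_(x in Rplus) sqmod k x)%:E)%E.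
  by move=> ik; rewrite fineK//; exact: integrable_fin_num.
rewrite !fT// !poweR_EFin -EFinM lee_fin -/H -powRM// ?mulr_ge0//.
apply: ge0_ler_powR; rewrite ?nnegrE ?mulr_ge0//.
  by apply: Rintegral_ge0 => x _; exact: sqnorm_ge0.
apply: (@le_trans _ _ (\int[mu]_(x in Rplus) bd x)); first exact: le_Rintegral.
rewrite RintegralD//; [|exact: intgZ|exact: intgZ].
rewrite !RintegralZl// -/A -/B; lra.
Qed.

Lemma resolvent_linear (c : R[i]) h1 h2 x : Rplus x -> L2 Rplus h1 -> L2 Rplus h2 ->
  T (fun y => c * h1 y + h2 y) x = c * T h1 x + T h2 x.
Proof.
move=> x0 L1 L2; rewrite /T.
have D1 : `]0, x]%classic `<=` (Rplus : set R).
  by move=> t; rewrite /= in_itv/= => /andP[].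
have D2 : `[x, +oo[%classic `<=` (Rplus : set R).
  by move=> t; rewrite /= in_itv/= andbT; exact: lt_le_trans.
have -> : (fun y => phi y * (c * h1 y + h2 y)) =
    (fun y => c * (phi y * h1 y) + phi y * h2 y).
  by apply/funext => y; ring.
have -> : (fun y => theta y * (c * h1 y + h2 y)) =
    (fun y => c * (theta y * h1 y) + theta y * h2 y).
  by apply/funext => y; ring.
rewrite !Cintegral_lin//; first ring; exact: L2_mul_Cintg.
Qed.

(** The second derivative comes from writing u' as 1 / p times p u', where 1 / p is C^1 with
    derivative - p' / p^2. The resulting density is a continuous function minus h / p, hence locally
    square-integrable. *)
Lemma resolvent_H2loc h : L2 Rplus h -> H2loc (T h).
Proof.
move=> Lh; have [cT cT1 cW] := resolvent_cac Lh.
have [mh _] := (L2P _ mP).1 Lh.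
pose r x := (p x)^-1; pose r1 x := - (p x) ^- 2 * derive1 p x.
have cr1 : cont_pos r1.
  apply: cont_posM; last by move=> x /p_C1[].
  apply: cont_posN; apply: cont_pos_eq (cont_posM pV_cont pV_cont) => x _.
  by rewrite -expr2 exprVn.
have cacr : cac (fun x => (r x)%:C) (fun x => (r1 x)%:C).
  split; last by have [] := cac_cst (0 : R[i]).
  apply: C1_ac => // x x0; have := @is_deriveV _ p x _ 1 (pn0 x0) (pD x0).
  exact.
have crC := Ccont_real cr1.
pose u2 x := (r x)%:C * (((q x)%:C - z) * T h x) + (r1 x)%:C * ((p x)%:C * T1 h x)
   + (- (r x))%:C * h x.
have cacT1 : cac (T1 h) u2.
  apply: cac_eq (cacM cW cacr crC) => x x0.
    by rewrite mulrC mulrA pVC// mul1r.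
  by rewrite /u2 rmorphN; ring.
have cT0 := cac_Ccont cT.
have cont2 : Ccont (fun x =>
    (r x)%:C * (((q x)%:C - z) * T h x) + (r1 x)%:C * ((p x)%:C * T1 h x)).
  apply: CcontD.
    apply: CcontM; first exact: Ccont_real.
    by apply: CcontM => //; apply: CcontD; [exact: Ccont_real|exact: Ccont_cst].
  by apply: CcontM => //; apply: CcontM => //; exact: Ccont_real.
have cNr : Ccont (fun x => (- r x)%:C) by apply/Ccont_real/cont_posN.
exists (T1 h), u2; split.
- by apply: cac_weak => //; exact: Ccont_measurable.
- apply: cac_weak => //; apply: CmeasurableD; first exact: Ccont_measurable.
  by apply: CmeasurableM => //; exact: Ccont_measurable.
- exact: L2loc_Ccont.
- exact: L2loc_Ccont.
- apply: L2locD; first exact: L2loc_Ccont.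
  by apply: L2loc_mul_Ccont => //; exact: L2_L2loc.
Qed.

Lemma resolvent_boundary h : L2 Rplus h -> boundary_condition alpha (T h).
Proof.
move=> Lh; have [cT cT1 cW] := resolvent_cac Lh.
have D x : 0 < x -> Cderivable (T h) x /\ Cderive (T h) x = T1 h x.
  exact: cac_Cderive.
have F0 := Cprim0_cvg (L2_mul_Cintg mP (@subset_refl _ _) phi_L2 Lh).
have G0 := Ctail_cvg (L2_mul_Cintg mP (@subset_refl _ _) theta_L2 Lh).
exists (T h); split.
- exact: aeW.
- move=> x x0; split; first by have [] := D x x0.
  have [cr ci] : Ccont (Cderive (T h)) by apply: Ccont_eq cT1 => y /D[].
  by split; [exact: cr|exact: ci].
- move: phi_init theta_init; rewrite /phi_data /theta_data.
  case: alpha => [a|] [f0 f1] [t0 t1].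
    (* As phi(0) = 1 and F(0) = 0, the value of T h at 0 is the limit of G, the full integral of
       theta h. *)
    exists (Cintegral Rplus (fun y => theta y * h y)); split.
      have := CcvgD (CcvgM t0 F0) (CcvgM f0 G0).
      by rewrite mulr0 add0r mul1r.
    have := CcvgD (CcvgM t1 F0) (CcvgM f1 G0).
    by rewrite mulr0 add0r; apply: Ccvg_eq => x /D[].
  have := CcvgD (CcvgM t0 F0) (CcvgM f0 G0).
  by rewrite mulr0 mul0r addr0.
Qed.

(** The density of p u' is (q - z) u - h, so that - (p u')' + q u = z u + h. *)
Lemma resolvent_calA h : L2 Rplus h ->
  Cmeasurable Rplus (calA p q (T h)) /\
  eq_aeRplus (calA p q (T h)) (fun x => z * T h x + h x).
Proof.
move=> Lh; have [cT cT1 cW] := resolvent_cac Lh.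
have [mh _] := (L2P _ mP).1 Lh.
have mT := Ccont_measurable (cac_Ccont cT).
have mg : Cmeasurable Rplus (fun x => ((q x)%:C - z) * T h x - h x).
  apply: CmeasurableD; last exact: CmeasurableN.
  apply: CmeasurableM => //; apply: Ccont_measurable.
  by apply: CcontD; [exact: Ccont_real|exact: Ccont_cst].
have [mA eA] := calA_eq_ae p_cont q_C cT cW (Ccont_measurable cT1) mg.
split=> //.
apply: (@filterS _ _ (ae_filter_ringOfSetsType mu) _ _ _ eA) => x E /E ->.
ring.
Qed.

End Solutions.

Theorem theorem3p1 (R : realType) (p q : R -> R) (p0 q0 : R)
  (alpha : option R) (phi theta : R[i] -> R -> R[i])
  (p_C1 : C1_Rplus p)
  (q_C : forall x, Rplus x -> {for x, continuous q})
  (p_lim : p x @[x --> 0^'+] --> p0)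
  (q_lim : q x @[x --> 0^'+] --> q0)
  (p_gt0 : forall x, Rplus x -> 0 < p x)
  (p0_gt0 : 0 < p0)
  (phi_sol : forall z, is_solution p q z (phi z))
  (phi_init : forall z, phi_data alpha (phi z))
  (theta_sol : forall z, is_solution p q z (theta z))
  (theta_init : forall z, theta_data p0 alpha (theta z))
  (phi_L2 : forall z, L2 Rplus (phi z))
  (theta_L2 : forall z, L2 Rplus (theta z)) :
  forall z : R[i],
    [/\ bounded_operator_L2 (Rop phi theta z),
        forall h, L2 Rplus h -> dom_Amax p q alpha (Rop phi theta z h)
      & forall h, L2 Rplus h ->
          eq_aeRplus
            (fun x => calA p q (Rop phi theta z h) x - z * Rop phi theta z h x)
            h].
Proof.
move=> z.
have [M HM] := resolvent_bounded p_C1 q_C p_lim p_gt0 p0_gt0 (phi_sol z)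
  (theta_sol z) (phi_init z) (theta_init z) (phi_L2 z) (theta_L2 z).
have HA := resolvent_calA p_C1 q_C p_lim p_gt0 p0_gt0 (phi_sol z)
  (theta_sol z) (phi_init z) (theta_init z) (phi_L2 z) (theta_L2 z).
split.
- split.
  + by move=> h /HM[].
  + by move=> c h1 h2 L1 L2'; apply: aeW => x x0; exact: resolvent_linear.
  + by exists M => h /HM[].
- move=> h Lh; have [LT _] := HM h Lh; have [mA eA] := HA h Lh; split => //.
  + exact: (resolvent_H2loc p_C1 q_C p_lim p_gt0 p0_gt0 (phi_sol z)
      (theta_sol z) (phi_init z) (theta_init z)).
  + exact: (resolvent_boundary p_C1 q_C p_lim p_gt0 p0_gt0 (phi_sol z)
      (theta_sol z) (phi_init z) (theta_init z)).
  (* Square integrability of [calA] is inherited from z u + h, with which it agrees almost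
     everywhere. *)
  + apply: L2_ae mA (eq_aeRplus_sym eA) _; first exact: measurable_Rplus.
    by apply: L2D => //; [exact: measurable_Rplus|apply: L2Z => //; exact: measurable_Rplus].
- move=> h Lh; have [_ eA] := HA h Lh.
  apply: (@filterS _ _ (ae_filter_ringOfSetsType _) _ _ _ eA) => x E /E ->.
  by rewrite addrC addKr.
Qed.
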